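(* Let $G$ be a decompleted symmetric X-ladder with $|V(G)|\ge 7$. That is, for an integer $m\ge 4$, let $\Gamma$ be the 4-regular graph with vertices $u_i,v_i$ ($i\in\mathbb{Z}/m\mathbb{Z}$) whose edges are $u_iu_{i+1},\,u_iv_{i+1},\,v_iu_{i+1},\,v_iv_{i+1}$ for all $i\in\mathbb{Z}/m\mathbb{Z}$, and let $G=\Gamma\setminus u_1$. Then $c_2^{(2)}(G)=0$.
   Context: $\Gamma\setminus u_1$ denotes the graph obtained by deleting the vertex $u_1$ and its incident edges; all vertices of $\Gamma$ are equivalent under automorphisms. For a connected graph $G$, assign a variable $\alpha_e$ to each edge $e$. The Kirchhoff polynomial is $\Psi_G=\sum_T\prod_{e\notin T}\alpha_e$, the sum running over all spanning trees $T$ of $G$. For a prime $p$, $[\Psi_G]_p$ is the number of zeros of $\Psi_G$ in $\mathbb{F}_p^{|E(G)|}$. If $G$ has at least 3 vertices, then $[\Psi_G]_p$ is divisible by $p^2$, and the $c_2$ invariant of $G$ at $p$ is $c_2^{(p)}(G)=\frac{[\Psi_G]_p}{p^2}\bmod p$. *)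

(* Defs.v *)
From HB Require Import structures.
From mathcomp Require Import all_boot all_order all_algebra.
From mathcomp Require Import mpoly.

Set Implicit Arguments.
Unset Strict Implicit.
Unset Printing Implicit Defensive.

Import GRing.Theory.
Local Open Scope ring_scope.

Record sgraph := SGraph {
  vertex : finType;
  adj : rel vertex;
  adj_sym : ssrbool.symmetric adj;
  adj_irrefl : irreflexive adj }.

Definition edges (G : sgraph) : {set {set vertex G}} :=
  [set e | [exists x, exists y, adj x y && (e == [set x; y])]].

Definition edge (G : sgraph) : finType := {e : {set vertex G} | e \in edges G}.

Section DeleteVertex.
Variables (G : sgraph) (v : vertex G).

Definition del_vertex_type : finType := {x : vertex G | x != v}.
Definition del_vertex_adj : rel del_vertex_type :=
  fun x y => adj (val x) (val y).

Lemma del_vertex_sym : ssrbool.symmetric del_vertex_adj.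
Proof. by move=> x y; apply: adj_sym. Qed.

Lemma del_vertex_irrefl : irreflexive del_vertex_adj.
Proof. by move=> x; apply: adj_irrefl. Qed.

Definition del_vertex : sgraph := SGraph del_vertex_sym del_vertex_irrefl.

End DeleteVertex.

Definition connected_rel (T : finType) (r : rel T) : bool :=
  [forall x, forall y, connect r x y].

(* A repetition-free cycle has at most #|T| vertices, so bounding the length
   loses nothing: see acyclic_relP. *)
Definition acyclic_rel (T : finType) (r : rel T) : bool :=
  [forall n : 'I_#|T|.+1, forall c : n.-tuple T,
     (2 < n)%N ==> ~~ ucycleb r c].

Lemma acyclic_relP (T : finType) (r : rel T) :
  reflect (forall c : seq T, (2 < size c)%N -> ~ ucycle r c) (acyclic_rel r).
Proof.
apply: (iffP forallP) => [acr c c3 cc | acr n].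
  have szc : (size c < #|T|.+1)%N.
    by case/andP: cc => _ /card_uniqP <-; rewrite ltnS max_card.
  have /forallP/(_ (in_tuple c))/implyP/(_ c3)/negP := acr (Ordinal szc).
  by apply.
apply/forallP => c; apply/implyP => n3; apply/negP; apply: acr.
by rewrite size_tuple.
Qed.

Section Kirchhoff.
Variable G : sgraph.

Definition span_rel (T : {set edge G}) : rel (vertex G) :=
  fun x y => [exists e in T, val e == [set x; y]].

Definition spanning_tree (T : {set edge G}) : bool :=
  connected_rel (span_rel T) && acyclic_rel (span_rel T).

Definition edge_var (R : comNzRingType) (e : edge G) : {mpoly R[#|edge G|]} :=
  'X_(enum_rank e).

Definition kirchhoff (R : comNzRingType) : {mpoly R[#|edge G|]} :=
  \sum_(T : {set edge G} | spanning_tree T)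
    \prod_(e | e \notin T) edge_var R e.

Definition kirchhoff_zeros (p : nat) : {set {ffun edge G -> 'F_p}} :=
  [set a : {ffun edge G -> 'F_p} | (kirchhoff 'F_p).@[fun i => a (enum_val i)] == 0].

(* The quotient is the truncated one of nat; for p prime and G connected with
   at least 3 vertices, p ^ 2 divides the number of zeros, so it is exact. *)
Definition c2 (p : nat) : 'F_p := (#|kirchhoff_zeros p| %/ p ^ 2)%:R.

End Kirchhoff.

Section XLadder.
Variable m : nat.

(* (i, false) is u_i and (i, true) is v_i; 'Z_m is Z/mZ only for m > 1. *)
Definition xladder_adj : rel ('Z_m * bool)%type :=
  fun x y => (y.1 == x.1 + 1) || (x.1 == y.1 + 1).

Lemma xladder_sym : ssrbool.symmetric xladder_adj.
Proof. by move=> x y; rewrite /xladder_adj orbC. Qed.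

Lemma xladder_irrefl : irreflexive xladder_adj.
Proof.
move=> x; rewrite /xladder_adj orbb; apply/negbTE.
by rewrite -subr_eq0 opprD addrA subrr sub0r oppr_eq0 oner_eq0.
Qed.

Definition xladder : sgraph := SGraph xladder_sym xladder_irrefl.

Definition ladder_u (i : 'Z_m) : vertex xladder := (i, false).

Definition decompleted_xladder : sgraph := del_vertex (ladder_u 1).

End XLadder.

(* Main.v *)
Require Import Defs.
From mathcomp Require Import all_boot all_order all_algebra.
From mathcomp Require Import mpoly.
From mathcomp Require Import fingroup perm.
From mathcomp Require Import ring zify.

(** Over F_2 the value of the Kirchhoff polynomial at a point with zero set C is
    the parity of the number of spanning trees T containing C, and T is a
    spanning tree iff the incidence vectors of its edges, grounded at a vertex w,
    form a basis. Take w of degree 3 with edges e1, e2, e3, and fix the other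
    coordinates. With f0 counting the trees of G - w, and l2, l3 counting the
    forests with two components that separate the ends of e1 and e3, resp. of e1
    and e2, the eight values at the remaining coordinates contain 4 zeros unless
    f0 = l2 = l3 = 0, when they contain 0 or 8. So the claim is that the number
    of points where f0, l2, l3 do not all vanish is even. Its indicator is
    f0 + (1 + f0) (l2 + l3 + l2 l3), and when f0 = 0 a symmetric matrix is
    singular, so that l2 l3 equals a mixed minor, again a sum over forests.
    Summing over all points leaves the number of pairs of a disjoint tree and
    forest; if |E| = 2|V| - 2 these partition the edges of G - w. Swapping two
    vertices with the same three neighbours acts on the pairs without fixed
    points, since an invariant tree or forest has no 4-cycle and so uses at most
    one of the three neighbours. In the ladder take w = u_2 and swap u_0, v_0. *)

Set Implicit Arguments.
Unset Strict Implicit.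
Unset Printing Implicit Defensive.

Import GRing.Theory.
Local Open Scope ring_scope.

(** * Bases of binary vectors *)

Lemma F2_eq01 (x : 'F_2) : x = (x != 0)%:R.
Proof. by case: x => [[|[|]]] // i; apply/val_inj. Qed.

Lemma F2_addxx (x : 'F_2) : x + x = 0.
Proof. by case: x => [[|[|]]] // i; apply/val_inj. Qed.

Lemma F2_natr (n : nat) : n%:R = (odd n)%:R :> 'F_2.
Proof. by apply/val_inj; rewrite /= !val_Fp_nat //= !modn2 oddb. Qed.

Lemma F2_add_eq0 (x y : 'F_2) : x + y = 0 -> x = y.
Proof. by move=> xy; rewrite -[LHS]addr0 -xy addrA F2_addxx add0r. Qed.

Lemma F2_eqP (x y : 'F_2) : (x != 0 <-> y != 0) -> x = y.
Proof.
move=> [xy yx]; rewrite (F2_eq01 x) (F2_eq01 y); congr (nat_of_bool _)%:R.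
exact/idP/idP.
Qed.

Section BinaryVectors.
Variables E V : finType.
Implicit Types (b c : E -> V -> 'F_2) (S C : {set E}).

Definition dotF2 (x y : V -> 'F_2) : 'F_2 := \sum_v x v * y v.

Definition indep b S := forall x : E -> 'F_2,
  (forall v, \sum_(e in S) x e * b e v = 0) -> forall e, e \in S -> x e = 0.

(** Spanning, stated dually: no nonzero [y] is orthogonal to all rows over [S]. For incidence
    vectors such a [y] is a potential constant on components, so this form matches connectedness
    directly. *)
Definition separating b S := forall y : V -> 'F_2,
  (forall e, e \in S -> dotF2 (b e) y = 0) -> forall v, y v = 0.

Definition rows_mx b S : 'M['F_2]_(#|S|, #|V|) :=
  \matrix_(i, j) b (enum_val i) (enum_val j).

(** Stated through ranks to be a boolean that can be summed; [basisP] gives back the two elementary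
    conditions. *)
Definition is_basis b S := row_free (rows_mx b S) && row_full (rows_mx b S).

Lemma rows_mx_mul b S n (A : 'M_(#|V|, n)) i j :
  (rows_mx b S *m A) i j =
  \sum_v b (enum_val i) v * A (enum_rank v) j.
Proof.
rewrite mxE [RHS](reindex_onto (@enum_val V V) enum_rank); last first.
  by move=> v _; rewrite enum_rankK.
by apply: eq_big => [k|k _]; rewrite ?enum_valK ?eqxx // !mxE.
Qed.

Lemma mul_rows_mx b S n (A : 'M_(n, #|S|)) i j :
  (A *m rows_mx b S) i j =
  \sum_k A i k * b (enum_val k) (enum_val j).
Proof. by rewrite mxE; apply: eq_bigr => k _; rewrite mxE. Qed.

Lemma indepP b S : indep b S <-> row_free (rows_mx b S).
Proof.
split=> [ind | /row_freeP[B AB] x x0 e eS].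
  apply: inj_row_free => v vA.
  pose x e := \sum_(k | enum_val k == e) v 0 k.
  have xE k : x (enum_val k) = v 0 k.
    by rewrite /x (big_pred1 k) // => l; rewrite (inj_eq enum_val_inj).
  apply/rowP => k; rewrite -xE mxE; apply: ind; last exact: enum_valP.
  move=> w; rewrite big_enum_val.
  have /matrixP/(_ 0 (enum_rank w)) := vA; rewrite mul_rows_mx [in RHS]mxE.
  by move=> E0; rewrite -[RHS]E0; apply: eq_bigr => l _; rewrite xE enum_rankK.
pose v : 'rV_#|S| := \row_k x (enum_val k).
have vA : v *m rows_mx b S = 0.
  apply/rowP => j; rewrite mul_rows_mx [RHS]mxE.
  have := x0 (enum_val j); rewrite big_enum_val => E0; rewrite -[RHS]E0.
  by apply: eq_bigr => k _; rewrite mxE.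
have v0 : v = 0 by rewrite -[v]mulmx1 -AB mulmxA vA mul0mx.
rewrite -(enum_rankK_in eS eS); have /rowP/(_ (enum_rank_in eS e)) := v0.
by rewrite !mxE.
Qed.

Lemma separatingP b S : separating b S <-> row_full (rows_mx b S).
Proof.
split=> [sep | /row_fullP[B AB] y y0 v].
  rewrite -cokermx_eq0; apply/eqP/matrixP => i j; rewrite [RHS]mxE.
  rewrite -[i]enum_valK; move: (enum_val i).
  apply: (sep (fun v => cokermx (rows_mx b S) (enum_rank v) j)) => e eS.
  have /matrixP/(_ (enum_rank_in eS e) j) := mulmx_coker (rows_mx b S).
  by rewrite rows_mx_mul enum_rankK_in // mxE.
pose w : 'cV_#|V| := \col_k y (enum_val k).
have Aw : rows_mx b S *m w = 0.
  apply/colP => i; rewrite rows_mx_mul [RHS]mxE -[RHS](y0 _ (enum_valP i)).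
  by apply: eq_bigr => u _; rewrite mxE enum_rankK.
have /colP/(_ (enum_rank v)) : w = 0 by rewrite -[w]mul1mx -AB -mulmxA Aw mulmx0.
by rewrite !mxE enum_rankK.
Qed.

Lemma basisP b S : is_basis b S <-> indep b S /\ separating b S.
Proof.
rewrite indepP separatingP.
by split=> [/andP[] | [A B]]; last exact/andP.
Qed.

Lemma basis_card b S : is_basis b S -> #|S| = #|V|.
Proof. by case/andP=> /eqP rS /eqP; rewrite rS. Qed.

Lemma separating_basis b S : #|S| = #|V| -> separating b S -> is_basis b S.
Proof.
move=> cS /separatingP fS; apply/andP; split=> //.
by rewrite /row_free (eqP fS) eq_sym; apply/eqP.
Qed.

(** One rank gives [#|S| <= #|V|] and the other the reverse; equality of the sizes then upgrades
    each half to a full basis. *)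
Lemma indep_separating b c S :
  indep b S /\ separating c S <-> is_basis b S && is_basis c S.
Proof.
split=> [[ib sc] | /andP[/basisP[ib _] /basisP[_ sc]]]; last by [].
have cS : #|S| = #|V|.
  move/indepP/eqP: (ib) => rb; move/separatingP/eqP: (sc) => rc.
  have := rank_leq_col (rows_mx b S); have := rank_leq_row (rows_mx c S).
  by rewrite rb rc => le1 le2; apply/eqP; rewrite eqn_leq le1 le2.
rewrite (separating_basis cS sc) andbT; apply/andP; split; first exact/indepP.
by move/indepP/eqP: ib => rb; rewrite /row_full rb cS.
Qed.

Lemma basis_solve b S (z : E -> 'F_2) :
  is_basis b S -> exists y, forall e, e \in S -> dotF2 (b e) y = z e.
Proof.
case/andP=> /row_freeP[B AB] _.
pose w : 'cV_#|S| := \col_k z (enum_val k).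
exists (fun v => (B *m w) (enum_rank v) 0) => e eS.
have := rows_mx_mul b (B *m w) (enum_rank_in eS e) 0.
by rewrite mulmxA AB mul1mx mxE enum_rankK_in.
Qed.

Lemma indep_ext b c S : {in S, b =1 c} -> indep b S -> indep c S.
Proof.
move=> bc ib x x0; apply: ib => v; rewrite -[RHS](x0 v).
by apply: eq_bigr => e /bc ->.
Qed.

Lemma separating_ext b c S : {in S, b =1 c} -> separating b S -> separating c S.
Proof. by move=> bc sb y y0; apply: sb => e eS; rewrite bc // y0. Qed.

Lemma eq_basis b c S : {in S, b =1 c} -> is_basis b S = is_basis c S.
Proof.
move=> bc; have cb : {in S, c =1 b} by move=> e /bc.
apply/idP/idP => /basisP[ib sb]; apply/basisP;
  by split; [apply: indep_ext ib | apply: separating_ext sb].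
Qed.

Lemma basis_nonzero b S e : b e =1 (fun=> 0) -> e \in S -> is_basis b S = false.
Proof.
move=> be eS; apply/negbTE/negP => /basisP[ib _].
have x0 v : \sum_(f in S) (f == e)%:R * b f v = 0.
  by apply: big1 => f _; case: eqP => [->|_]; rewrite ?be ?mulr0 ?mul0r.
by have /eqP := ib (fun f => (f == e)%:R) x0 e eS; rewrite eqxx oner_eq0.
Qed.

(** Moving a test functional along [rho] carries separation from [S] to [pi @: S] and back, and the
    sizes agree. *)
Lemma imset_basis b (pi : {perm E}) (rho : {perm V}) S :
  (forall e v, b (pi e) (rho v) = b e v) -> is_basis b (pi @: S) = is_basis b S.
Proof.
move=> brho.
have sub (T : {set E}) : separating b T -> separating b (pi @: T).
  move=> sT y y0 v; rewrite -[v](permKV rho); apply: (sT (y \o rho)) => e eT.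
  rewrite -[RHS](y0 (pi e)) ?imset_f // /dotF2 [RHS](reindex_inj (@perm_inj _ rho)).
  by apply: eq_bigr => u _; rewrite brho.
have cardpi : #|pi @: S| = #|S| by rewrite card_imset //; apply: perm_inj.
apply/idP/idP => bS; have /basisP[_ sS] := bS; have cS := basis_card bS;
  apply: separating_basis; rewrite ?cardpi -?cS ?cardpi //; last exact: sub.
move=> y y0 v; pose y' u := y ((rho^-1)%g u).
have -> : y v = y' (rho v) by rewrite /y' permK.
apply: sS => _ /imsetP[e eS ->].
rewrite -[RHS](y0 e) // /dotF2 (reindex_inj (@perm_inj _ rho)).
by apply: eq_bigr => u _; rewrite brho /y' permK.
Qed.

End BinaryVectors.

(** * Determinants as sums over bases *)

(** Multilinearity in the rows: each row is a diagonal row plus a row of [A], and [U] records where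
    the diagonal one was chosen. For a fixed permutation this is distributivity of the product. *)
Lemma det_add_diag (R : comNzRingType) n (d : 'I_n -> R) (A : 'M[R]_n) :
  \det (\matrix_(i, j) (d i * (i == j)%:R + A i j)) =
  \sum_(U : {set 'I_n}) (\prod_(i in U) d i) *
    \det (\matrix_(i, j) if i \in U then (i == j)%:R else A i j).
Proof.
rewrite /determinant; under [RHS]eq_bigr => U _ do rewrite mulr_sumr.
rewrite exchange_big; apply: eq_bigr => s _ /=.
under eq_bigr => i _ do rewrite mxE.
rewrite bigA_distr mulr_sumr; apply: eq_bigr => U _.
rewrite [RHS]mulrCA; congr (_ * _).
under [X in _ * X]eq_bigr => i _ do rewrite mxE.
rewrite [\prod_(i in U) d i]big_mkcond -big_split /=; apply: eq_bigr => i _.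
by case: ifP => // _; rewrite mul1r.
Qed.

Section Kernel.
Variable J : finType.
Implicit Type M : J -> J -> 'F_2.

Definition mx_of M : 'M['F_2]_#|J| := \matrix_(i, j) M (enum_val i) (enum_val j).

Lemma mx_of_mul M n (A : 'M_(#|J|, n)) i j :
  (mx_of M *m A) (enum_rank i) j = \sum_k M i k * A (enum_rank k) j.
Proof.
rewrite mxE [RHS](reindex_onto (@enum_val J J) enum_rank); last first.
  by move=> k _; rewrite enum_rankK.
by apply: eq_big => [k|k _]; rewrite ?enum_valK ?eqxx // mxE enum_rankK.
Qed.

Lemma det_mx_of_neq0 M : \det (mx_of M) != 0 <->
  (forall z : J -> 'F_2, (forall i, dotF2 (M i) z = 0) -> forall j, z j = 0).
Proof.
rewrite -unitfE -unitmxE -row_full_unit.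
split=> [/row_fullP[B AB] z z0 j | inj].
  pose w : 'cV_#|J| := \col_k z (enum_val k).
  have Aw : mx_of M *m w = 0.
    apply/colP => i; rewrite -[i]enum_valK mx_of_mul [RHS]mxE.
    rewrite -[RHS](z0 (enum_val i)).
    by apply: eq_bigr => u _; rewrite mxE enum_rankK.
  have /colP/(_ (enum_rank j)) : w = 0 by rewrite -[w]mul1mx -AB -mulmxA Aw mulmx0.
  by rewrite !mxE enum_rankK.
rewrite -cokermx_eq0; apply/eqP/matrixP => i j; rewrite [RHS]mxE -[i]enum_valK.
move: (enum_val i) => {}i.
apply: (inj (fun v => cokermx (mx_of M) (enum_rank v) j)) => k.
by have /matrixP/(_ (enum_rank k) j) := mulmx_coker (mx_of M); rewrite mx_of_mul mxE.
Qed.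

Lemma det_mx_of_add_diag (d : pred J) M :
  \det (mx_of (fun i j => (d i)%:R * (i == j)%:R + M i j)) =
  \sum_(U : {set J} | U \subset d)
    \det (mx_of (fun i j => if i \in U then (i == j)%:R else M i j)).
Proof.
transitivity (\det (\matrix_(i, j) ((d (enum_val i))%:R * (i == j)%:R + mx_of M i j))).
  by congr (\det _); apply/matrixP => i j; rewrite !mxE (inj_eq enum_val_inj).
rewrite det_add_diag [RHS](reindex_onto (fun U : {set 'I_#|J|} => enum_val @: U)
  (fun U : {set J} => enum_rank @: U)) /=; last first.
  move=> U _; rewrite -imset_comp -[RHS]imset_id; apply: eq_imset => i.
  by rewrite /= enum_rankK.
have UK (U : {set 'I_#|J|}) : enum_rank @: (enum_val @: U) = U.
  by rewrite -imset_comp -[RHS]imset_id; apply: eq_imset => i; rewrite /= enum_valK.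
rewrite [RHS]big_mkcond /=; apply: eq_bigr => U _; rewrite UK eqxx andbT.
have -> : (enum_val @: U \subset d) = [forall i in U, d (enum_val i)].
  apply/subsetP/forall_inP => [sub i iU | all_d _ /imsetP[i iU ->]].
    by apply: sub; apply: imset_f.
  exact: all_d.
case: ifP => [/forall_inP all_d | /forall_inPn[i iU /negbTE di]]; last first.
  by rewrite (bigD1 i) //= di !mul0r.
rewrite big1 ?mul1r => [|i /all_d ->] //; congr (\det _).
apply/matrixP => i j; rewrite !mxE (inj_eq enum_val_inj).
by rewrite (mem_imset _ _ enum_val_inj).
Qed.

End Kernel.

(** * Saddle-point matrices and a Cauchy-Binet formula mod 2 *)

Section SaddleSystem.
Variables E V : finType.
Implicit Types (b c : E -> V -> 'F_2) (S C : {set E}).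

(** Kernel of the block matrix whose diagonal blocks are the indicator of the complement of [C] and
    zero, and whose off-diagonal blocks are [c] and the transpose of [b]. *)
Definition saddle C b c (x : E -> 'F_2) (y : V -> 'F_2) : Prop :=
  (forall e, (e \notin C)%:R * x e + dotF2 (c e) y = 0) /\
  (forall v, \sum_e x e * b e v = 0).

(** A Cauchy-Binet sum: products of maximal minors of [b] and [c] mod 2. For [b = c] it is the
    parity of the number of bases containing [C]. *)
Definition basis_sum C b c : 'F_2 :=
  \sum_(S : {set E} | C \subset S) (is_basis b S && is_basis c S)%:R.

(** The sum is the determinant of the saddle matrix. Expanding along its diagonal turns the rows of
    a set avoiding [C] into unit rows; with [S] its complement, the remaining determinant is nonzero
    exactly when [b] is independent and [c] separating on [S]. *)
Lemma basis_sumP C b c : basis_sum C b c != 0 <->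
  (forall x y, saddle C b c x y -> (forall e, x e = 0) /\ (forall v, y v = 0)).
Proof.
pose M (i j : E + V) : 'F_2 := match i, j with
  | inl e, inr v => c e v | inr v, inl e => b e v | _, _ => 0 end.
pose d (i : E + V) := if i is inl e then e \notin C else false.
have sumE (F : E + V -> 'F_2) : \sum_i F i = \sum_e F (inl e) + \sum_v F (inr v).
  by rewrite big_sumType.
have dotE (e : E) (y : E -> 'F_2) : \sum_f (e == f)%:R * y f = y e.
  rewrite (bigD1 e) //= eqxx mul1r big1 ?addr0 // => f /negbTE.
  by rewrite eq_sym => ->; rewrite mul0r.
have -> : basis_sum C b c = \det (mx_of (fun i j => (d i)%:R * (i == j)%:R + M i j)).
  rewrite det_mx_of_add_diag /basis_sum.
  (* Sets of replaced rows inside the support of the diagonal correspond, by complementation, to the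
     sets [S] containing [C]. *)
  rewrite [RHS](reindex_onto (fun S : {set E} => inl @: ~: S)
    (fun U : {set E + V} => ~: (inl @^-1: U))) /=; last first.
    move=> U /subsetP Ud; rewrite setCK; apply/setP => -[e|v]; last first.
      by apply/imsetP/idP => [[]|/Ud].
    apply/imsetP/idP => [[f fU ->]|eU]; first by rewrite inE in fU.
    by exists e; rewrite ?inE.
  have inlE S e : ((inl e : E + V) \in inl @: ~: S) = (e \notin S).
    by rewrite mem_imset ?inE //; apply: inl_inj.
  have inrE S v : ((inr v : E + V) \in inl @: ~: S) = false.
    by apply/negP => /imsetP[].
  apply: eq_big => [S | S _].
    rewrite -[LHS]andbT; congr (_ && _); last first.
      by apply/esym/eqP/setP => e; rewrite !inE inlE negbK.
    apply/subsetP/subsetP => [CS [e|v] | sub e eC]; rewrite ?inlE ?inrE //.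
      by move=> eS; apply: contra eS => /CS.
    by apply: contraLR eC => eS; apply: (sub (inl e)); rewrite inlE.
  rewrite [RHS]F2_eq01; congr (_ %:R); congr nat_of_bool; apply/idP/idP.
    (* Unit rows kill the coordinates outside [S]; the other [inl] rows make the [inr] part
       orthogonal to [c] on [S], and the [inr] rows are a relation of [b] on [S]. *)
    move=> /indep_separating[ib sc]; apply/det_mx_of_neq0 => z z0.
    have zC e : e \notin S -> z (inl e) = 0.
      move=> eS; rewrite -[RHS](z0 (inl e)) /dotF2 inlE eS -[LHS](dotE e (z \o inl)) sumE.
      by rewrite [X in _ + X]big1 ?addr0 // => v _; rewrite mul0r.
    have zV v : z (inr v) = 0.
      apply: (sc (z \o inr)) => e eS; rewrite -[RHS](z0 (inl e)) /dotF2 inlE eS.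
      by rewrite sumE /= [X in X + _]big1 ?add0r // => f _; rewrite mul0r.
    case=> // e; case eS: (e \in S); last by rewrite zC ?eS.
    apply: (ib (z \o inl)) => // v; rewrite -[RHS](z0 (inr v)) /dotF2.
    rewrite sumE [X in _ + X]big1 ?addr0 => [|u _]; last by rewrite inrE mul0r.
    rewrite big_mkcond /=; apply: eq_bigr => f _; rewrite inrE mulrC.
    by case: ifP => // /negbT/zC ->; rewrite mulr0.
  move=> /det_mx_of_neq0 inj; apply/indep_separating; split=> [x x0 e eS | y y0 v].
    pose z (i : E + V) := if i is inl f then (if f \in S then x f else 0) else 0.
    have <- : z (inl e) = x e by rewrite /z eS.
    apply: inj => -[f|v]; rewrite /dotF2.
      rewrite inlE sumE; have [fS|/negbTE fS] := boolP (f \in S); last first.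
        rewrite (dotE f (z \o inl)) /= fS big1 ?addr0 // => v _; rewrite mulr0 //.
      by rewrite !big1 ?addr0 // => v _; rewrite ?mulr0 ?mul0r.
    rewrite inrE sumE [X in _ + X]big1 ?addr0 => [|u _]; last by rewrite mulr0.
    rewrite -[RHS](x0 v) [RHS]big_mkcond; apply: eq_bigr => f _ /=.
    by case: ifP; rewrite ?mulr0 // mulrC.
  pose z (i : E + V) := if i is inr u then y u else 0.
  apply: (inj z _ (inr v)) => -[e|u]; rewrite /dotF2.
    rewrite inlE sumE; have [eS|/negbTE eS] := boolP (e \in S); last first.
      by rewrite (dotE e (z \o inl)) add0r big1 // => u _; rewrite mul0r.
    rewrite big1 ?add0r => [|f _]; last by rewrite mulr0.
    exact: y0.
  by rewrite inrE sumE !big1 ?addr0 // => f _; rewrite ?mulr0 ?mul0r.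
rewrite det_mx_of_neq0; split=> [inj x y [xy1 xy2] | inj z z0].
  pose z i := match i with inl e => x e | inr v => y v end.
  have z0 : forall j, z j = 0.
    apply: inj => -[e|v]; rewrite /dotF2 sumE /=.
      rewrite -[RHS](xy1 e) /dotF2; congr (_ + _).
        rewrite -[in RHS](dotE e x) mulr_sumr; apply: eq_bigr => f _.
        by rewrite addr0 mulrA.
      by apply: eq_bigr => v _; rewrite mulr0 add0r.
    rewrite -[RHS](xy2 v) [X in _ + X]big1 ?addr0 => [|u _]; last by rewrite mul0r add0r mul0r.
    by apply: eq_bigr => f _; rewrite mul0r add0r mulrC.
  by split=> [e|v]; [apply: (z0 (inl e)) | apply: (z0 (inr v))].
have [|x0 y0] := inj (z \o inl) (z \o inr); last by case.
split=> [e|v]; [rewrite -[RHS](z0 (inl e)) | rewrite -[RHS](z0 (inr v))];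
  rewrite /dotF2 sumE /=.
  congr (_ + _).
    rewrite -[z (inl e) in LHS](dotE e (z \o inl)) mulr_sumr; apply: eq_bigr => f _.
    by rewrite addr0 mulrA.
  by apply: eq_bigr => v _; rewrite mulr0 add0r.
rewrite [X in _ + X]big1 ?addr0 => [|u _]; last by rewrite mul0r add0r mul0r.
by apply: eq_bigr => f _; rewrite mul0r add0r mulrC.
Qed.

End SaddleSystem.

(** * Bordered singular systems *)

Section RestrictedBases.
Variables E V : finType.
Implicit Types (b c : E -> V -> 'F_2) (S C X : {set E}).

(** A zeroed row lies in no basis, so bases are confined to subsets of [X] while the index type
    stays the same. *)
Definition restrict b X : E -> V -> 'F_2 :=
  fun e => if e \in X then b e else fun=> 0.

Lemma restrict_in b X e : e \in X -> restrict b X e = b e.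
Proof. by rewrite /restrict => ->. Qed.

Lemma restrict_out b X e : e \notin X -> restrict b X e = fun=> 0.
Proof. by rewrite /restrict => /negbTE ->. Qed.

Lemma dotF2_0l (y : V -> 'F_2) : dotF2 (fun=> 0) y = 0.
Proof. by apply: big1 => v _; rewrite mul0r. Qed.

Lemma dotF2_addmul (x y z : V -> 'F_2) (t : 'F_2) :
  dotF2 x (fun v => y v + t * z v) = dotF2 x y + t * dotF2 x z.
Proof.
rewrite /dotF2 mulr_sumr -big_split; apply: eq_bigr => v _ /=.
by rewrite mulrDr mulrCA.
Qed.

Lemma dotF2_mulr (x y z : V -> 'F_2) (t : 'F_2) :
  (forall v, y v = t * z v) -> dotF2 x y = t * dotF2 x z.
Proof.
by move=> yz; rewrite /dotF2 mulr_sumr; apply: eq_bigr => v _; rewrite yz mulrCA.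
Qed.

Lemma basis_restrict b X S : is_basis (restrict b X) S = (S \subset X) && is_basis b S.
Proof.
case: (boolP (S \subset X)) => [/subsetP sX | /subsetPn[e eS eX]] /=.
  by apply: eq_basis => e eS; rewrite restrict_in ?sX.
by apply: basis_nonzero eS => v; rewrite restrict_out.
Qed.

Lemma basis_sumC C b c : basis_sum C b c = basis_sum C c b.
Proof. by apply: eq_bigr => S _; rewrite andbC. Qed.

Section Bordered.
Variables (b : E -> V -> 'F_2) (K : {set E}) (p q : E).
Hypotheses (pq : p != q) (pK : p \notin K) (qK : q \notin K).

Let bpq := restrict b (~: [set p; q]).
Let bp := restrict b (~: [set p]).
Let bq := restrict b (~: [set q]).

(* Row [p] of the system is that of [b q], while its column stays that of [b p]. *)
Definition mixed e := if e == p then b q else restrict b (~: [set q]) e.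

(** The unbordered system is symmetric, so pairing one of its solutions with the equations of a
    bordered system cancels everything but the border term. *)
Lemma saddle_pairing (x xi : E -> 'F_2) (y psi u : V -> 'F_2) (t : 'F_2) :
  (forall e, e \notin [set p; q] -> (e \notin K)%:R * x e + dotF2 (b e) y = 0) ->
  (forall v, \sum_(e | e \notin [set p; q]) x e * b e v + t * u v = 0) ->
  saddle K bpq bpq xi psi -> t * dotF2 u psi = 0.
Proof.
move=> xy1 xy2 [xp1 xp2].
have bpqE e : e \notin [set p; q] -> bpq e = b e.
  by move=> epq; rewrite /bpq restrict_in ?inE -?in_set2.
have xipq e : e \in [set p; q] -> xi e = 0.
  move=> epq; have := xp1 e; rewrite /bpq restrict_out ?inE ?negbK -?in_set2 //.
  rewrite dotF2_0l addr0 (_ : e \notin K) ?mul1r //.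
  by move: epq; rewrite !inE => /orP[]/eqP->.
have sum0 : \sum_v psi v * (\sum_(e | e \notin [set p; q]) x e * b e v + t * u v) = 0.
  by apply: big1 => v _; rewrite xy2 mulr0.
(* The row equations of both systems turn [x e * dotF2 (b e) psi] into [xi e * dotF2 (b e) y]; the
   column equations for [xi] then make the total vanish. *)
have sumxi : \sum_(e | e \notin [set p; q]) x e * dotF2 (b e) psi = 0.
  transitivity (\sum_e xi e * dotF2 (bpq e) y).
    rewrite [RHS](bigID (fun e => e \notin [set p; q])) /= [X in _ + X]big1 ?addr0; last first.
      by move=> e; rewrite negbK => /xipq ->; rewrite mul0r.
    apply: eq_bigr => e epq; have := xp1 e; rewrite bpqE // => /F2_add_eq0 <-.
    by have /F2_add_eq0 <- := xy1 e epq; ring.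
  rewrite /dotF2; under eq_bigr => e _ do rewrite mulr_sumr.
  rewrite exchange_big big1 //= => v _; under eq_bigr => e _ do rewrite mulrA.
  by rewrite -mulr_suml xp2 mul0r.
rewrite -[RHS]sum0 -[LHS]add0r -[X in X + _]sumxi.
under [RHS]eq_bigr => v _ do rewrite mulrDr mulr_sumr.
rewrite big_split exchange_big /= /dotF2; congr (_ + _).
  by apply: eq_bigr => e _; rewrite mulr_sumr; apply: eq_bigr => v _; ring.
by rewrite /dotF2 mulr_sumr; apply: eq_bigr => v _; ring.
Qed.

Let offpq (g : E -> V -> 'F_2) := forall e, e \notin [set p; q] -> g e = b e.

Let columnE g (x : E -> 'F_2) v : offpq g ->
  \sum_e x e * g e v =
  \sum_(e | e \notin [set p; q]) x e * b e v + (x p * g p v + x q * g q v).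
Proof.
move=> gb; rewrite (bigID (mem [set p; q])) /= addrC; congr (_ + _).
  by apply: eq_bigr => e /gb ->.
by rewrite big_setU1 ?inE //= big_set1.
Qed.

(** The equations shared by the unbordered system and by every bordered one once the coordinates at
    [p] and [q] vanish. *)
Let core (x : E -> 'F_2) (y : V -> 'F_2) :=
  [/\ x p = 0, x q = 0,
      forall e, e \notin [set p; q] -> (e \notin K)%:R * x e + dotF2 (b e) y = 0 &
      forall v, \sum_(e | e \notin [set p; q]) x e * b e v = 0].

Let core_saddle (K' : {set E}) g h x y : offpq g -> offpq h ->
  (forall e, e \notin [set p; q] -> (e \in K') = (e \in K)) ->
  core x y -> dotF2 (h p) y = 0 -> dotF2 (h q) y = 0 -> saddle K' g h x y.
Proof.
move=> gb hb KK' [xp xq xy1 xy2] hp hq; split=> [e|v].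
  case: (boolP (e \in [set p; q])) => [|epq]; last by rewrite KK' // hb // xy1.
  by rewrite !inE => /orP[]/eqP->; rewrite ?xp ?xq mulr0 add0r.
by rewrite (columnE _ _ gb) xy2 xp xq !mul0r !addr0.
Qed.

Let saddle_core (K' : {set E}) g h x y : offpq g -> offpq h ->
  (forall e, e \notin [set p; q] -> (e \in K') = (e \in K)) ->
  saddle K' g h x y -> x p = 0 -> x q = 0 -> core x y.
Proof.
move=> gb hb KK' [xy1 xy2] xp xq; split=> // [e epq | v].
  by have := xy1 e; rewrite KK' // hb.
by have := xy2 v; rewrite (columnE _ _ gb) xp xq !mul0r !addr0.
Qed.

(** The Desnanot-Jacobi identity for a symmetric matrix bordered by the rows of [p] and [q]: when
    the unbordered determinant is zero, the product of the two principal minors is the square of the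
    mixed one, and squaring is trivial over F_2. The proof compares kernels. *)
Lemma basis_sum_bordered : basis_sum K bpq bpq = 0 ->
  basis_sum (q |: K) bp bp * basis_sum (p |: K) bq bq = basis_sum (p |: K) bq mixed.
Proof.
move=> f0; have qp : q != p by rewrite eq_sym.
have offbpq : offpq bpq.
  by move=> e; rewrite !inE => epq; rewrite /bpq restrict_in ?inE.
have bpqp : bpq p = fun=> 0 by rewrite /bpq restrict_out // !inE eqxx.
have bpqq : bpq q = fun=> 0 by rewrite /bpq restrict_out // !inE eqxx orbT.
have singular : ~ (forall x y, core x y -> (forall e, x e = 0) /\ (forall v, y v = 0)).
  move=> sing; have /basis_sumP : forall x y, saddle K bpq bpq x y ->
      (forall e, x e = 0) /\ (forall v, y v = 0); last by rewrite f0 eqxx.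
  move=> x y xy; have xp := xy.1 p; have xq := xy.1 q; apply: sing.
  move: xp xq; rewrite bpqp bpqq dotF2_0l !addr0 pK qK !mul1r => xp xq.
  exact: saddle_core xy xp xq.
have offbp : offpq bp.
  by move=> e; rewrite !inE negb_or => /andP[ep eq]; rewrite /bp restrict_in ?inE.
have offbq : offpq bq.
  by move=> e; rewrite !inE negb_or => /andP[ep eq]; rewrite /bq restrict_in ?inE.
have offm : offpq mixed.
  by move=> e epq; rewrite /mixed -/bq offbq // ifN //; apply: contra epq; rewrite !inE => ->.
have bpp : bp p = fun=> 0 by rewrite /bp restrict_out // !inE eqxx.
have bqq : bq q = fun=> 0 by rewrite /bq restrict_out // !inE eqxx.
have bpq' : bp q = b q by rewrite /bp restrict_in // !inE.
have bqp : bq p = b p by rewrite /bq restrict_in // !inE.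
have mp : mixed p = b q by rewrite /mixed eqxx.
have mq : mixed q = fun=> 0 by rewrite /mixed (negbTE qp) -/bq bqq.
have KpE e : e \notin [set p; q] -> (e \in p |: K) = (e \in K).
  by rewrite !inE negb_or => /andP[/negbTE ->].
have KqE e : e \notin [set p; q] -> (e \in q |: K) = (e \in K).
  by rewrite !inE negb_or => /andP[_ /negbTE ->].
have xq0 (g h : E -> V -> 'F_2) x y : saddle (p |: K) g h x y -> h q = (fun=> 0) -> x q = 0.
  move=> [xy1 _] hq; have := xy1 q; rewrite hq dotF2_0l addr0 !inE negb_or qp.
  by rewrite (negbTE qK) mul1r.
have xp0 (g h : E -> V -> 'F_2) x y : saddle (q |: K) g h x y -> h p = (fun=> 0) -> x p = 0.
  move=> [xy1 _] hp; have := xy1 p; rewrite hp dotF2_0l addr0 !inE negb_or pq.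
  by rewrite (negbTE pK) mul1r.
have dot_p (g h : E -> V -> 'F_2) x y : saddle (p |: K) g h x y -> dotF2 (h p) y = 0.
  by case=> /(_ p); rewrite setU11 mul0r add0r.
have dot_q (g h : E -> V -> 'F_2) x y : saddle (q |: K) g h x y -> dotF2 (h q) y = 0.
  by case=> /(_ q); rewrite setU11 mul0r add0r.
(* A nonzero border coordinate of a solution forces the border to vanish on the
   kernel of the unbordered system, which would then be nonsingular. *)
have border (K' : {set E}) g h x y e : offpq g -> offpq h ->
    (forall f, f \notin [set p; q] -> (f \in K') = (f \in K)) ->
    saddle K' g h x y -> (forall v, x p * g p v + x q * g q v = x e * b e v) ->
    (forall xi psi, core xi psi -> dotF2 (b e) psi = 0 ->
      (forall f, xi f = 0) /\ (forall v, psi v = 0)) -> x e = 0.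
  move=> gb hb KK' [xy1 xy2] xE nonsing; apply/eqP/negPn/negP => xe.
  apply: singular => xi psi cxi; apply: nonsing => //.
  have saddle_xi : saddle K bpq bpq xi psi by apply: core_saddle; rewrite ?bpqp ?bpqq ?dotF2_0l.
  have : x e * dotF2 (b e) psi = 0; last first.
    by move/eqP; rewrite mulf_eq0 (negbTE xe) => /eqP.
  apply: saddle_pairing saddle_xi => [f fpq|v]; first by rewrite -KK' // -hb // xy1.
  by rewrite -xE -columnE.
(* It suffices that both principal systems are nonsingular exactly when the mixed one is. *)
apply: F2_eqP; rewrite mulf_eq0 negb_or; split=> [/andP[]|f1].
  move=> /basis_sumP l2 /basis_sumP l3; apply/basis_sumP => x y xy.
  have xq := xq0 _ _ _ _ xy mq.
  have xp : x p = 0.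
    apply: (border _ _ _ _ _ _ offbq offm KpE xy) => [v|xi psi cxi bpsi].
      by rewrite xq mul0r addr0 bqp.
    by apply: l3; apply: core_saddle; rewrite ?bqp ?bqq ?dotF2_0l.
  apply: l2; apply: core_saddle; rewrite ?bpp ?bpq' ?dotF2_0l //.
    by apply: saddle_core xy xp xq.
  by rewrite -mp (dot_p _ _ _ _ xy).
(* The transpose of the mixed system is nonsingular too; each of the two settles one principal
   system. *)
have /basis_sumP f1' := f1; have /basis_sumP f1t : basis_sum (p |: K) mixed bq != 0.
  by rewrite basis_sumC.
apply/andP; split; apply/basis_sumP => x y xy.
  have xp := xp0 _ _ _ _ xy bpp.
  have byq : dotF2 (b q) y = 0 by rewrite -bpq' (dot_q _ _ _ _ xy).
  have xq : x q = 0.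
    apply: (border _ _ _ _ _ _ offbp offbp KqE xy) => [v|xi psi cxi bpsi].
      by rewrite xp mul0r add0r bpq'.
    by apply: f1'; apply: core_saddle; rewrite ?mp ?mq ?dotF2_0l.
  apply: f1'; apply: core_saddle; rewrite ?mp ?mq ?dotF2_0l //.
  by apply: saddle_core xy xp xq.
have xq := xq0 _ _ _ _ xy bqq.
have byp : dotF2 (b p) y = 0 by rewrite -bqp (dot_p _ _ _ _ xy).
have xp : x p = 0.
  apply: (border _ _ _ _ _ _ offbq offbq KpE xy) => [v|xi psi cxi bpsi].
    by rewrite xq mul0r addr0 bqp.
  by apply: f1t; apply: core_saddle; rewrite ?bqp ?bqq ?dotF2_0l.
apply: f1t; apply: core_saddle; rewrite ?bqp ?bqq ?dotF2_0l //.
by apply: saddle_core xy xp xq.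
Qed.
End Bordered.
End RestrictedBases.

(** * Extensions along a three-element cocircuit *)

Lemma card_set3 (T : finType) (x y z : T) : uniq [:: x; y; z] -> #|[set x; y; z]| = 3%N.
Proof.
move=> u; transitivity #|[:: x; y; z]|; last by rewrite (card_uniqP u).
by apply: eq_card => t; rewrite !inE orbA.
Qed.

Section SubsetSums.
Variables (E : finType) (R : Type) (idx : R) (op : Monoid.com_law idx).

Definition insert (e : E) (t : bool) (S : {set E}) := if t then e |: S else S.

Lemma in_insert e t S f : (f \in insert e t S) = (f == e) && t || (f \in S).
Proof. by rewrite /insert; case: t; rewrite ?inE ?andbT ?andbF. Qed.

Lemma big_subset_setU1 (X : {set E}) e (F : {set E} -> R) : e \notin X ->
  \big[op/idx]_(C : {set E} | C \subset e |: X) F C =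
  \big[op/idx]_(C : {set E} | C \subset X) \big[op/idx]_(t : bool) F (insert e t C).
Proof.
move=> eX; under [RHS]eq_bigr => C _ do rewrite big_bool /=.
rewrite big_split /= (bigID (fun C : {set E} => e \in C)) /=; congr (op _ _).
  rewrite (reindex_onto (fun C : {set E} => e |: C) (fun C : {set E} => C :\ e)) /=; last first.
    by move=> C /andP[_ eC]; rewrite setD1K.
  apply: eq_bigl => C; rewrite setU11 andbT.
  have [eC|eC] := boolP (e \in C).
    rewrite [RHS](contraNF _ eX) => [|/subsetP/(_ e eC) //].
    by apply/negbTE; rewrite negb_and orbC (contraTneq _ eC) // => <-; rewrite setD11.
  rewrite setU1K // eqxx andbT; apply/idP/idP => [sub|]; last exact: setUS.
  apply/subsetP => f fC; have := subsetP sub f; rewrite !inE fC orbT => /(_ isT).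
  by case/orP=> // /eqP fe; rewrite fe (negbTE eC) in fC.
apply: eq_bigl => C; apply/andP/idP => [[CX eC] | CX].
  apply/subsetP => f fC; have := subsetP CX f fC; rewrite !inE.
  by case/orP=> // /eqP fe; rewrite fe (negbTE eC) in fC.
split; first exact: subset_trans CX (subsetUr _ _).
by apply: contra eX => /(subsetP CX).
Qed.

Variables e1 e2 e3 : E.
Hypothesis e123 : uniq [:: e1; e2; e3].

Definition insert3 (t1 t2 t3 : bool) (S : {set E}) :=
  insert e1 t1 (insert e2 t2 (insert e3 t3 S)).

Definition base3 : {set E} := ~: [set e1; e2; e3].

Lemma big_set_insert3 (F : {set E} -> R) :
  \big[op/idx]_(C : {set E}) F C =
  \big[op/idx]_(C : {set E} | C \subset base3)
    \big[op/idx]_(t3 : bool) \big[op/idx]_(t2 : bool) \big[op/idx]_(t1 : bool)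
      F (insert3 t1 t2 t3 C).
Proof.
have full : e1 |: (e2 |: (e3 |: base3)) = [set: E].
  by apply/setP => e; rewrite !inE; case: (e == e1); case: (e == e2); case: (e == e3).
move: e123; rewrite /= !inE negb_or => /and3P[/andP[e12 e13] e23 _].
rewrite (eq_bigl (fun C : {set E} => C \subset e1 |: (e2 |: (e3 |: base3)))); last first.
  by move=> C; rewrite full subsetT.
rewrite big_subset_setU1; last by rewrite !inE (negbTE e12) (negbTE e13) eqxx.
rewrite big_subset_setU1; last by rewrite !inE (negbTE e23) eqxx orbT.
by rewrite big_subset_setU1 // !inE eqxx orbT.
Qed.

Lemma insert3_subset s1 s2 s3 t1 t2 t3 (C S : {set E}) :
  C \subset base3 -> S \subset base3 ->
  (insert3 s1 s2 s3 C \subset insert3 t1 t2 t3 S) =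
  [&& s1 ==> t1, s2 ==> t2, s3 ==> t3 & C \subset S].
Proof.
move: e123; rewrite /= !inE negb_or => /and3P[/andP[e12 e13] e23 _].
move=> CB SB.
have out (T : {set E}) e : T \subset base3 -> e \in [set e1; e2; e3] -> e \in T = false.
  by move=> /subsetP TB eD; apply/negP => /TB; rewrite inE eD.
have D1 : e1 \in [set e1; e2; e3] by rewrite !inE eqxx.
have D2 : e2 \in [set e1; e2; e3] by rewrite !inE eqxx orbT.
have D3 : e3 \in [set e1; e2; e3] by rewrite !inE eqxx orbT.
apply/subsetP/and4P => [sub | [s1t s2t s3t /subsetP CS] e].
  have sub1 := sub e1; have sub2 := sub e2; have sub3 := sub e3.
  rewrite !in_insert !(out _ _ CB) // !(out _ _ SB) // !eqxx in sub1 sub2 sub3.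
  rewrite (eq_sym e2 e1) (eq_sym e3) (eq_sym e3 e2) in sub1 sub2 sub3.
  rewrite (negbTE e12) (negbTE e13) (negbTE e23) in sub1 sub2 sub3.
  rewrite /= !orbF in sub1 sub2 sub3; split; try exact/implyP.
  apply/subsetP => e eC; have := sub e; rewrite !in_insert eC !orbT => /(_ isT).
  by case/or4P=> [/andP[/eqP ee _]|/andP[/eqP ee _]|/andP[/eqP ee _]|//];
    rewrite ee (out _ _ CB) in eC.
rewrite !in_insert => /or4P[]; last by move/CS => ->; rewrite !orbT.
- by case/andP=> -> /(implyP s1t) ->.
- by case/andP=> -> /(implyP s2t) ->; rewrite orbT.
- by case/andP=> -> /(implyP s3t) ->; rewrite !orbT.
Qed.

End SubsetSums.

(** A set has a power of two of subsets, which is odd only for the empty set. *)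
Lemma F2_sum_supersets (E : finType) (B T : {set E}) : T \subset B ->
  \sum_(C : {set E} | (C \subset B) && (C \subset T)) 1 = (T == set0)%:R :> 'F_2.
Proof.
move=> TB; rewrite (eq_bigl (mem (powerset T))) => [|C]; last first.
  by rewrite !inE; apply: andb_idl => /subset_trans; apply.
rewrite sumr_const card_powerset [LHS]F2_natr oddX -cards_eq0.
by case: #|T|.
Qed.

Section ThreeCocircuit.
Variables (E V : finType) (b : E -> V -> 'F_2) (e1 e2 e3 : E).
(** A functional equal to 1 exactly on the three elements exhibits them as a cut. For incidence
    vectors grounded at a vertex of degree three it is the all-ones vector. *)
Variable phi : V -> 'F_2.
Hypothesis e123 : uniq [:: e1; e2; e3].
Hypothesis b_phi : forall e, dotF2 (b e) phi = (e \in [set e1; e2; e3])%:R.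

Local Notation B := (base3 e1 e2 e3).
Local Notation ins := (insert3 e1 e2 e3).
Local Notation beta S := ((is_basis b S)%:R : 'F_2).

Definition basis_count (C : {set E}) : 'F_2 :=
  \sum_(S : {set E} | C \subset S) beta S.

(** The bits fix the trace of a basis on the cocircuit, so [basis_count] at each of the eight points
    over [C] is a sum of such terms. The quantities [f0], [l2], [l3] have bits [true false false],
    [true false true] and [true true false]. *)
Definition extension_sum t1 t2 t3 (C : {set E}) : 'F_2 :=
  \sum_(S : {set E} | (S \subset B) && (C \subset S)) beta (ins t1 t2 t3 S).

Lemma sum_insert3 s1 s2 s3 (C : {set E}) (F : {set E} -> 'F_2) : C \subset B ->
  \sum_(S : {set E} | ins s1 s2 s3 C \subset S) F S =
  \sum_(t3 : bool) \sum_(t2 : bool) \sum_(t1 : bool)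
    if [&& s1 ==> t1, s2 ==> t2 & s3 ==> t3] then
      \sum_(S : {set E} | (S \subset B) && (C \subset S)) F (ins t1 t2 t3 S)
    else 0.
Proof.
move=> CB; rewrite big_mkcond (big_set_insert3 _ e123).
rewrite exchange_big; apply: eq_bigr => t3 _.
rewrite exchange_big; apply: eq_bigr => t2 _.
rewrite exchange_big; apply: eq_bigr => t1 _ /=.
case: ifP => [/and3P[st1 st2 st3]|cond]; last first.
  apply: big1 => S SB; rewrite insert3_subset // ifN //.
  by apply: contraFN cond => /and4P[-> -> ->].
rewrite [RHS]big_mkcondr; apply: eq_bigr => S SB.
by rewrite insert3_subset // st1 st2 st3.
Qed.


(** * Exchange of elements inside the cocircuit *)

Section Exchange.
Variable S : {set E}.
Hypothesis SB : S \subset B.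

Let phi_S e : e \in S -> dotF2 (b e) phi = 0.
Proof.
move=> eS; rewrite b_phi; have := subsetP SB e eS.
by rewrite in_setC => /negbTE ->.
Qed.

Let notin_S e : e \in [set e1; e2; e3] -> e \notin S.
Proof. by move=> eD; apply: contraL eD => /(subsetP SB); rewrite in_setC. Qed.

(** A basis meets every cut: [phi] is a nonzero functional vanishing on [S]. *)
Lemma basis_base3 : is_basis b S = false.
Proof.
apply/negP => /basisP[_ sS]; have phi0 := sS phi phi_S.
have := b_phi e1; rewrite !inE eqxx /= /dotF2 big1 => [/eqP|v _].
  by rewrite eq_sym oner_eq0.
by rewrite phi0 mulr0.
Qed.

(** A functional vanishing on [S] is determined by its value at [p], hence is a multiple of [phi],
    and [phi] is 1 at [q]. *)
Lemma basis_exchange p q : p \in [set e1; e2; e3] -> q \in [set e1; e2; e3] ->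
  is_basis b (p |: S) -> is_basis b (q |: S).
Proof.
move=> pD qD bpS; have /basisP[_ sep] := bpS.
apply: separating_basis => [|y y0].
  by rewrite -(basis_card bpS) !cardsU1 !notin_S.
set t := dotF2 (b p) y.
have y_phi v : y v = t * phi v.
  apply: F2_add_eq0; apply: (sep (fun v => y v + t * phi v)) => e.
  rewrite dotF2_addmul => /setU1P[->|eS]; first by rewrite b_phi pD mulr1 F2_addxx.
  by rewrite phi_S // y0 ?mulr0 ?addr0 // setU1r.
have t0 : t = 0.
  by rewrite -[RHS](y0 q (setU11 _ _)) (dotF2_mulr _ y_phi) b_phi qD mulr1.
by move=> v; rewrite y_phi t0 mul0r.
Qed.

(** The functionals vanishing on [S] are spanned by [phi] and by a [y] with value 1 at [p] and 0 at
    [q]. Exactly one of [y] and [y + phi] vanishes at [r], so modulo [S] the row of [r] agrees with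
    that of [q] or of [p], respectively. *)
Lemma basis_exchange2 p q r :
  p \in [set e1; e2; e3] -> q \in [set e1; e2; e3] -> r \in [set e1; e2; e3] ->
  uniq [:: p; q; r] ->
  is_basis b (p |: (q |: S)) -> is_basis b (p |: (r |: S)) (+) is_basis b (q |: (r |: S)).
Proof.
move=> pD qD rD; rewrite /= !inE negb_or => /and3P[/andP[pq pr] qr _] bpq.
have cpq := basis_card bpq; have /basisP[_ sep] := bpq.
have card2 e f : e \in [set e1; e2; e3] -> f \in [set e1; e2; e3] -> e != f ->
    #|e |: (f |: S)| = #|S|.+2.
  by move=> eD fD ef; rewrite !cardsU1 in_setU1 (negbTE ef) !notin_S.
rewrite card2 // in cpq.
have [y yE] := basis_solve (fun e => (e == p)%:R) bpq.
have yp : dotF2 (b p) y = 1 by rewrite yE ?eqxx // setU11.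
have yq : dotF2 (b q) y = 0 by rewrite yE ?(eq_sym q) ?(negbTE pq) // !inE eqxx orbT.
have yS e : e \in S -> dotF2 (b e) y = 0.
  move=> eS; rewrite yE ?inE ?eS ?orbT //; case: eqP => // ep.
  by have := notin_S pD; rewrite -ep eS.
have zero e (x : V -> 'F_2) : dotF2 (b e) x = 1 -> ~ (forall v, x v = 0).
  move=> ex x0; have /eqP := ex; rewrite /dotF2 big1 => [|v _]; last by rewrite x0 mulr0.
  by rewrite eq_sym oner_eq0.
have phiD e : e \in [set e1; e2; e3] -> dotF2 (b e) phi = 1 by move=> eD; rewrite b_phi eD.
have [yr|yr] : dotF2 (b r) y = 0 \/ dotF2 (b r) y = 1.
  by rewrite (F2_eq01 (dotF2 _ _)); case: (_ == 0); [left|right].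
- have -> : is_basis b (q |: (r |: S)) = false.
    apply/negP => /basisP[_ sqr]; apply: (zero p y yp).
    by apply: sqr => e; rewrite !inE => /or3P[/eqP->|/eqP->|/yS].
  rewrite addbF; apply: separating_basis => [|z z0]; first by rewrite card2.
  have zp : dotF2 (b p) z = 0 by apply: z0; rewrite !inE eqxx.
  have zr : dotF2 (b r) z = 0 by apply: z0; rewrite !inE eqxx orbT.
  have zS e : e \in S -> dotF2 (b e) z = 0 by move=> eS; apply: z0; rewrite !inE eS !orbT.
  set t := dotF2 (b q) z.
  have zE v : z v = t * (y v + 1 * phi v).
    apply: F2_add_eq0; apply: (sep (fun v => z v + t * (y v + 1 * phi v))) => e.
    rewrite 2!dotF2_addmul !inE => /or3P[/eqP->|/eqP->|eS].
    + by rewrite zp yp phiD // mul1r F2_addxx mulr0 addr0.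
    + by rewrite yq phiD // mul1r add0r mulr1 F2_addxx.
    + by rewrite zS // yS // phi_S // !(mulr0, addr0).
  have t0 : t = 0.
    by rewrite -[RHS]zr (dotF2_mulr _ zE) dotF2_addmul yr phiD // mul1r add0r mulr1.
  by move=> v; rewrite zE t0 mul0r.
- have -> : is_basis b (p |: (r |: S)) = false.
    apply/negP => /basisP[_ spr]; apply: (zero q (fun v => y v + 1 * phi v)).
      by rewrite dotF2_addmul yq phiD // mul1r add0r.
    apply: spr => e; rewrite dotF2_addmul mul1r !inE => /or3P[/eqP->|/eqP->|eS].
    + by rewrite yp phiD // F2_addxx.
    + by rewrite yr phiD // F2_addxx.
    + by rewrite yS // phi_S // addr0.
  rewrite addFb; apply: separating_basis => [|z z0]; first by rewrite card2.
  have zq : dotF2 (b q) z = 0 by apply: z0; rewrite !inE eqxx.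
  have zr : dotF2 (b r) z = 0 by apply: z0; rewrite !inE eqxx orbT.
  have zS e : e \in S -> dotF2 (b e) z = 0 by move=> eS; apply: z0; rewrite !inE eS !orbT.
  set t := dotF2 (b p) z.
  have zE v : z v = t * y v.
    apply: F2_add_eq0; apply: (sep (fun v => z v + t * y v)) => e.
    rewrite dotF2_addmul !inE => /or3P[/eqP->|/eqP->|eS].
    + by rewrite yp mulr1 F2_addxx.
    + by rewrite zq yq mulr0 addr0.
    + by rewrite zS // yS // mulr0 addr0.
  have t0 : t = 0.
    by rewrite -[RHS]zr (dotF2_mulr _ zE) yr mulr1.
  by move=> v; rewrite zE t0 mul0r.
Qed.

(** The number of pairs completing [S] is 0 or 2. In the graph, a forest with two components either
    leaves the three ends together or separates one from the other two. *)
Lemma basis_pair_sum :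
  beta (ins true true false S) + beta (ins true false true S) +
  beta (ins false true true S) = 0.
Proof.
have D1 : e1 \in [set e1; e2; e3] by rewrite !inE eqxx.
have D2 : e2 \in [set e1; e2; e3] by rewrite !inE eqxx orbT.
have D3 : e3 \in [set e1; e2; e3] by rewrite !inE eqxx orbT.
move: e123; rewrite /= !inE negb_or => /and3P[/andP[e12 e13] e23 _].
have [e21 e31 e32] : [/\ e2 != e1, e3 != e1 & e3 != e2] by rewrite !(eq_sym _ e1) (eq_sym e3).
have [u123 u132 u231] : [/\ uniq [:: e1; e2; e3], uniq [:: e1; e3; e2] & uniq [:: e2; e3; e1]].
  by rewrite /= !inE !negb_or e12 e13 e23 e21 e31 e32.
have p12 := basis_exchange2 D1 D2 D3 u123.
have p13 := basis_exchange2 D1 D3 D2 u132.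
have p23 := basis_exchange2 D2 D3 D1 u231.
rewrite [e3 |: (e2 |: S)]setUCA in p13.
rewrite [e3 |: (e1 |: S)]setUCA [e2 |: (e1 |: S)]setUCA in p23.
rewrite /insert3 /insert; move: p12 p13 p23.
case: (is_basis b _); case: (is_basis b _); case: (is_basis b _) => //= h1 h2 h3;
  rewrite ?addr0 ?add0r ?F2_addxx //.
- by have := h1 isT.
- by have := h1 isT.
- by have := h2 isT.
- by have := h3 isT.
Qed.

End Exchange.

Lemma extension_sum000 (C : {set E}) : extension_sum false false false C = 0.
Proof. by apply: big1 => S /andP[SB _]; rewrite basis_base3. Qed.

Lemma extension_sum1 (C : {set E}) :
  extension_sum false true false C = extension_sum true false false C /\
  extension_sum false false true C = extension_sum true false false C.
Proof.
have D1 : e1 \in [set e1; e2; e3] by rewrite !inE eqxx.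
have D2 : e2 \in [set e1; e2; e3] by rewrite !inE eqxx orbT.
have D3 : e3 \in [set e1; e2; e3] by rewrite !inE eqxx orbT.
split; apply: eq_bigr => S /andP[SB _]; congr (nat_of_bool _)%:R;
  by apply/idP/idP; apply: basis_exchange.
Qed.

Lemma extension_sum2 (C : {set E}) :
  extension_sum false true true C =
  extension_sum true true false C + extension_sum true false true C.
Proof.
rewrite -big_split; apply: eq_bigr => S /andP[SB _] /=.
by apply/esym/F2_add_eq0/basis_pair_sum.
Qed.

(** The eight counts depend only on [f0], [l2], [l3] and the sum [k] over bases containing the whole
    cocircuit, which leaves sixteen cases. If [f0 = l2 = l3 = 0], all eight counts equal [k];
    otherwise exactly four vanish. *)
Lemma zero_count_mod8 (C : {set E}) : C \subset B ->
  (8 %| \sum_(t3 : bool) \sum_(t2 : bool) \sum_(t1 : bool)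
          (basis_count (ins t1 t2 t3 C) == 0%R) +
        4 * ~~ [&& extension_sum true false false C == 0%R,
                   extension_sum true false true C == 0%R &
                   extension_sum true true false C == 0%R])%N.
Proof.
move=> CB; have [E010 E001] := extension_sum1 C; have E011 := extension_sum2 C.
have E000 := extension_sum000 C; move: E000 E010 E001 E011; rewrite /extension_sum.
rewrite !big_bool /basis_count !sum_insert3 // !big_bool /= => -> -> -> ->.
move: (\sum_(S | _) beta (ins true true true S)) => k.
move: (\sum_(S | _) beta (ins true true false S)) => l3.
move: (\sum_(S | _) beta (ins true false true S)) => l2.
move: (\sum_(S | _) beta (ins true false false S)) => f0.
rewrite (F2_eq01 k) (F2_eq01 l3) (F2_eq01 l2) (F2_eq01 f0).
by case: (k == 0); case: (l3 == 0); case: (l2 == 0); case: (f0 == 0); vm_compute.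
Qed.

(** Since [mixed] puts the row of [e3] at [e2], for [S] inside the base set this says that [e1, e2]
    and [e1, e3] both complete [S] to a basis. The form is that of the summand of the mixed
    minor. *)
Definition mixed_basis (S : {set E}) :=
  is_basis b (ins true true false S) && is_basis (mixed b e2 e3) (ins true true false S).

Lemma mem_insert3 t1 t2 t3 (S : {set E}) : S \subset B ->
  [/\ (e1 \in ins t1 t2 t3 S) = t1, (e2 \in ins t1 t2 t3 S) = t2 &
      (e3 \in ins t1 t2 t3 S) = t3].
Proof.
move: e123; rewrite /= !inE negb_or => /and3P[/andP[e12 e13] e23 _] /subsetP SB.
have out e : e \in [set e1; e2; e3] -> (e \in S) = false.
  by move=> eD; apply/negP => /SB; rewrite inE eD.
rewrite !in_insert !out ?inE ?eqxx ?orbT // (eq_sym e2 e1) !(eq_sym e3).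
by rewrite (negbTE e12) (negbTE e13) (negbTE e23) !orbF.
Qed.

(** Supersets have all the set bits, and a zero row of [g] at each unset bit excludes any further
    one. *)
Lemma basis_sum_insert3 t1 t2 t3 (C : {set E}) (g h : E -> V -> 'F_2) : C \subset B ->
  (~~ t1 -> g e1 = fun=> 0) -> (~~ t2 -> g e2 = fun=> 0) -> (~~ t3 -> g e3 = fun=> 0) ->
  basis_sum (ins t1 t2 t3 C) g h =
  \sum_(S : {set E} | (S \subset B) && (C \subset S))
    (is_basis g (ins t1 t2 t3 S) && is_basis h (ins t1 t2 t3 S))%:R.
Proof.
move=> CB g1 g2 g3; rewrite /basis_sum sum_insert3 //.
transitivity
  (\sum_(s3 : bool) \sum_(s2 : bool) \sum_(s1 : bool)
     if [&& s1 == t1, s2 == t2 & s3 == t3] then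
       \sum_(S : {set E} | (S \subset B) && (C \subset S))
         (is_basis g (ins t1 t2 t3 S) && is_basis h (ins t1 t2 t3 S))%:R : 'F_2
     else 0); last first.
  by rewrite !big_bool; case: t1 {g1}; case: t2 {g2}; case: t3 {g3}; rewrite /= !(addr0, add0r).
apply: eq_bigr => s3 _; apply: eq_bigr => s2 _; apply: eq_bigr => s1 _.
case: ifP => [/and3P[st1 st2 st3]|]; last first.
  move/negbT => ne; rewrite ifN //; apply: contra ne => /and3P[/eqP-> /eqP-> /eqP->].
  by rewrite !implybb.
have null r1 r2 r3 e : g e = (fun=> 0) ->
    (forall S : {set E}, S \subset B -> e \in ins r1 r2 r3 S) ->
    \sum_(S : {set E} | (S \subset B) && (C \subset S))
      (is_basis g (ins r1 r2 r3 S) && is_basis h (ins r1 r2 r3 S))%:R = 0 :> 'F_2.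
  move=> ge eS; apply: big1 => S /andP[SB _].
  by rewrite (@basis_nonzero _ _ _ _ e) ?eS // => v; rewrite ge.
case: (eqVneq s1 t1) => [-> | s1t] /=; last first.
  apply: (null _ _ _ e1 (g1 _)) _ => [|S SB]; first by case: (t1) (s1) s1t st1 => [] [].
  by have [-> _ _] := mem_insert3 s1 s2 s3 SB; case: (t1) (s1) s1t st1 => [] [].
case: (eqVneq s2 t2) => [-> | s2t] /=; last first.
  apply: (null _ _ _ e2 (g2 _)) _ => [|S SB]; first by case: (t2) (s2) s2t st2 => [] [].
  by have [_ -> _] := mem_insert3 t1 s2 s3 SB; case: (t2) (s2) s2t st2 => [] [].
case: (eqVneq s3 t3) => [-> | s3t] //=.
apply: (null _ _ _ e3 (g3 _)) _ => [|S SB]; first by case: (t3) (s3) s3t st3 => [] [].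
by have [_ _ ->] := mem_insert3 t1 t2 s3 SB; case: (t3) (s3) s3t st3 => [] [].
Qed.

(** An instance of [basis_sum_bordered] with [K = e1 |: C] and borders [e2], [e3]; the elements a
    basis must avoid are encoded by zeroed rows. *)
Lemma extension_sum_mixed (C : {set E}) : C \subset B ->
  extension_sum true false false C = 0 ->
  extension_sum true false true C * extension_sum true true false C =
  \sum_(S : {set E} | (S \subset B) && (C \subset S)) (mixed_basis S)%:R.
Proof.
move=> CB; have memC t1 t2 t3 := mem_insert3 t1 t2 t3 CB.
move: (e123); rewrite /= !inE negb_or => /and3P[/andP[e12 e13] e23 _].
have e2C : e2 \notin e1 |: C by have [_ ->] := memC true false false.
have e3C : e3 \notin e1 |: C by have [_ _ ->] := memC true false false.
have rE t1 t2 t3 (X : {set E}) :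
    (~~ t1 -> e1 \in X) -> (~~ t2 -> e2 \in X) -> (~~ t3 -> e3 \in X) ->
    (forall S : {set E}, S \subset B -> ins t1 t2 t3 S \subset ~: X) ->
    extension_sum t1 t2 t3 C = basis_sum (ins t1 t2 t3 C) (restrict b (~: X)) (restrict b (~: X)).
  move=> X1 X2 X3 sX; rewrite basis_sum_insert3 //; last first.
  - by move=> /X3 eX; rewrite restrict_out // inE eX.
  - by move=> /X2 eX; rewrite restrict_out // inE eX.
  - by move=> /X1 eX; rewrite restrict_out // inE eX.
  by apply: eq_bigr => S /andP[SB _]; rewrite andbb basis_restrict sX.
have b0 : extension_sum true false false C =
    basis_sum (e1 |: C) (restrict b (~: [set e2; e3])) (restrict b (~: [set e2; e3])).
  apply: rE => [//|||S SB]; rewrite ?inE ?eqxx ?orbT //.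
  have [_ m2 m3] := mem_insert3 true false false SB.
  by rewrite subsetC subUset !sub1set !in_setC m2 m3.
have b3 : extension_sum true true false C =
    basis_sum (e2 |: (e1 |: C)) (restrict b (~: [set e3])) (restrict b (~: [set e3])).
  rewrite setUCA; apply: rE => [//|//||S SB]; rewrite ?inE ?eqxx ?orbT //.
  by have [_ m2 m3] := mem_insert3 true true false SB; rewrite subsetC !sub1set !in_setC m3.
have b2 : extension_sum true false true C =
    basis_sum (e3 |: (e1 |: C)) (restrict b (~: [set e2])) (restrict b (~: [set e2])).
  rewrite setUCA; apply: rE => [//||//|S SB]; rewrite ?inE ?eqxx ?orbT //.
  by have [_ m2 m3] := mem_insert3 true false true SB; rewrite subsetC !sub1set !in_setC m2.
rewrite b0 b2 b3 => /basis_sum_bordered -> //.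
rewrite setUCA (basis_sum_insert3 (t1 := true) (t2 := true) (t3 := false)) //; last first.
  by rewrite restrict_out // !inE eqxx.
apply: eq_bigr => S /andP[SB _]; rewrite basis_restrict.
have [_ _ m3] := mem_insert3 true true false SB.
by rewrite subsetC sub1set in_setC m3.
Qed.

(** * Reduction to disjoint pairs *)

Hypothesis V3 : (2 < #|V|)%N.

Definition tree_part (S : {set E}) : 'F_2 := beta (ins true false false S).
(** The summand of [l2 + l3 + l2 l3] with the product replaced by the mixed minor, a replacement
    valid where [f0 = 0]. *)
Definition forest_part (S : {set E}) : 'F_2 :=
  beta (ins true false true S) + beta (ins true true false S) + (mixed_basis S)%:R.

(** After exchanging the sums, [S] is counted once for each of its subsets, so only the empty set
    survives mod 2. *)
Lemma sum_sum_supersets (g : {set E} -> 'F_2) :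
  \sum_(C : {set E} | C \subset B) \sum_(S : {set E} | (S \subset B) && (C \subset S)) g S =
  g set0.
Proof.
rewrite (exchange_big_dep (fun S : {set E} => S \subset B)) => [|C S _ /andP[]//] /=.
transitivity (\sum_(S : {set E} | S \subset B) g S * (S == set0)%:R).
  apply: eq_bigr => S SB; rewrite -(F2_sum_supersets SB) mulr_sumr.
  by apply: eq_big => [C|C _]; rewrite ?SB ?mulr1.
rewrite (bigD1 set0) ?sub0set //= eqxx mulr1 big1 ?addr0 // => S /andP[_ /negbTE->].
by rewrite mulr0.
Qed.

(** Here a pair is counted once for each subset of [T :&: S], so the disjoint pairs survive. *)
Lemma sum_sum_supersets2 (g h : {set E} -> 'F_2) :
  \sum_(C : {set E} | C \subset B)
    (\sum_(T : {set E} | (T \subset B) && (C \subset T)) g T) *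
    (\sum_(S : {set E} | (S \subset B) && (C \subset S)) h S) =
  \sum_(T : {set E} | T \subset B) \sum_(S : {set E} | (S \subset B) && [disjoint T & S])
    g T * h S.
Proof.
under eq_bigr => C _ do rewrite mulr_suml.
rewrite (exchange_big_dep (fun T : {set E} => T \subset B)) => [|C T _ /andP[]//] /=.
apply: eq_bigr => T TB; under eq_bigr => C _ do rewrite mulr_sumr.
rewrite (exchange_big_dep (fun S : {set E} => S \subset B)) => [|C S _ /andP[]//] /=.
rewrite [RHS]big_mkcondr; apply: eq_bigr => S SB.
transitivity (g T * h S * (T :&: S == set0)%:R); last first.
  by rewrite setI_eq0; case: ifP; rewrite ?mulr1 ?mulr0.
rewrite -(@F2_sum_supersets _ B) ?(subset_trans (subsetIl _ _)) // mulr_sumr.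
apply: eq_big => [C|C _]; last by rewrite mulr1.
by rewrite TB SB subsetI /=; case: (C \subset B); case: (C \subset T); case: (C \subset S).
Qed.

Lemma tree_part0 : tree_part set0 = 0.
Proof.
rewrite /tree_part; case: (boolP (is_basis _ _)) => // /basis_card c.
by move: V3; rewrite -c /insert3 /insert cardsU1 in_set0 cards0.
Qed.

Lemma forest_part0 : forest_part set0 = 0.
Proof.
have card_pair e f : #|e |: (f |: set0)| <> #|V|.
  move=> c; move: V3; rewrite -c !cardsU1 cards0 !inE.
  by case: (e == f).
rewrite /forest_part /mixed_basis.
have -> : is_basis b (ins true false true set0) = false.
  by apply/negP => /basis_card/card_pair.
have -> : is_basis b (ins true true false set0) = false.
  by apply/negP => /basis_card/card_pair.
by rewrite !addr0.
Qed.

Theorem zeros_mod8 :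
  \sum_(T : {set E} | T \subset B) \sum_(S : {set E} | (S \subset B) && [disjoint T & S])
     tree_part T * forest_part S = 0 ->
  (8 %| #|[set C : {set E} | basis_count C == 0%R]|)%N.
Proof.
move=> pairs0.
pose H (C : {set E}) := ~~ [&& extension_sum true false false C == 0,
  extension_sum true false true C == 0 & extension_sum true true false C == 0].
(* With [m] the forest sum, the right side is [f0 + m + f0 m]. For [f0 = 1] the terms in [m] cancel;
   for [f0 = 0] it is [l2 + l3 + l2 l3], which is zero only if [l2 = l3 = 0]. *)
have HE (C : {set E}) : C \subset B -> (H C)%:R =
    \sum_(T : {set E} | (T \subset B) && (C \subset T)) tree_part T +
    \sum_(S : {set E} | (S \subset B) && (C \subset S)) forest_part S +
    (\sum_(T : {set E} | (T \subset B) && (C \subset T)) tree_part T) *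
    \sum_(S : {set E} | (S \subset B) && (C \subset S)) forest_part S :> 'F_2.
  move=> CB; have := extension_sum_mixed CB; rewrite 2!big_split /=.
  rewrite /H /tree_part -/(extension_sum true false false C).
  rewrite -/(extension_sum true false true C) -/(extension_sum true true false C).
  move: (extension_sum true false false C) => f0.
  move: (extension_sum true true false C) => l3; move: (extension_sum true false true C) => l2.
  move: (\sum_(S | _) _) => m.
  have [-> /(_ erefl) <-|->] : f0 = 0 \/ f0 = 1.
    by rewrite (F2_eq01 f0); case: (f0 == 0); [left|right].
    rewrite (F2_eq01 l2) (F2_eq01 l3).
    by case: (l2 == 0); case: (l3 == 0); vm_compute; apply/val_inj.
  by move=> _; rewrite oner_eq0 mul1r -[RHS]addrA F2_addxx addr0.
(* Summed over [C], the linear terms collapse to the empty set and vanish because bases have more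
   than two elements; the product term is the hypothesis. Hence the total of [4 * H C] is a multiple
   of 8. *)
have odd0 : ~~ odd (\sum_(C : {set E} | C \subset B) H C).
  suff : (\sum_(C : {set E} | C \subset B) H C)%:R = 0 :> 'F_2.
    by rewrite F2_natr; case: (odd _) => //.
  rewrite natr_sum (eq_bigr _ HE) big_split big_split /= sum_sum_supersets2 pairs0.
  by rewrite !sum_sum_supersets tree_part0 forest_part0 !addr0.
have dv8 : (8 %| \sum_(C : {set E} | C \subset B)
    (\sum_(t3 : bool) \sum_(t2 : bool) \sum_(t1 : bool)
       (basis_count (ins t1 t2 t3 C) == 0%R) + 4 * H C))%N.
  by apply: dvdn_sum => C /zero_count_mod8.
rewrite big_split /= -big_distrr /= in dv8.
rewrite dvdn_addl in dv8; last by rewrite (dvdn_pmul2l (p := 4) (d := 2)) // dvdn2.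
have -> : #|[set C : {set E} | basis_count C == 0]| =
    (\sum_(C : {set E}) (basis_count C == 0%R))%N.
  by rewrite -sum1dep_card big_mkcond; apply: eq_bigr => C _; case: eqP.
by rewrite (big_set_insert3 _ e123).
Qed.

End ThreeCocircuit.

(** * Spanning trees as bases *)

Section Incidence.
Variables (G : sgraph) (w : vertex G).
Implicit Types (S T : {set edge G}) (e : edge G) (x y : vertex G).

(** Dropping the coordinate of [w] removes the relation that all coordinates of an edge sum to zero,
    so that spanning trees become bases. *)
Definition incidence (e : edge G) (v : {v : vertex G | v != w}) : 'F_2 :=
  (val v \in val e)%:R.

Lemma edgeP e : exists x y, [/\ adj x y, x != y & val e = [set x; y]].
Proof.
have := valP e; rewrite inE => /existsP[x /existsP[y /andP[xy /eqP exy]]].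
exists x, y; split=> //; apply: contraTneq xy => ->; by rewrite adj_irrefl.
Qed.

Lemma edge_neq e x y : val e = [set x; y] -> x != y.
Proof.
have [a [c [_ ac ->]]] := edgeP e => /setP E; apply: contraNneq ac => xy.
by have := E a; have := E c; rewrite !inE xy !eqxx orbT !orbb /= => /esym/eqP-> /esym/eqP->.
Qed.

(** A functional is a potential normalised to 0 at [w], and an edge measures the difference of
    potential between its ends. *)
Lemma dot_incidence e x y (z : vertex G -> 'F_2) : val e = [set x; y] ->
  z w = 0 -> dotF2 (incidence e) (fun v => z (val v)) = z x + z y.
Proof.
move=> exy zw; have xy := edge_neq exy; transitivity (\sum_(v | v != w) (v \in val e)%:R * z v).
  rewrite [RHS](reindex_omap (val : {v | v != w} -> _) insub) => [|v vw]; last by rewrite insubT.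
  by apply: eq_bigl => v; rewrite valK eqxx (valP v).
rewrite big_mkcond; transitivity (\sum_(v in val e) z v).
  rewrite [RHS]big_mkcond; apply: eq_bigr => v _.
  by case: eqP => [->|_] /=; case: ifP; rewrite ?zw ?mul1r ?mul0r.
by rewrite exy big_setU1 ?inE //= big_set1.
Qed.

Lemma span_rel_sym T : ssrbool.symmetric (span_rel T).
Proof. by move=> x y; apply: eq_existsb => e; rewrite setUC. Qed.

Lemma span_relP T x y : reflect (exists2 e, e \in T & val e = [set x; y]) (span_rel T x y).
Proof.
apply: (iffP existsP) => [[e /andP[eT /eqP exy]]|[e eT exy]]; exists e => //.
by rewrite eT exy eqxx.
Qed.

Lemma span_rel_subset S T : S \subset T -> subrel (span_rel S) (span_rel T).
Proof.
by move=> /subsetP ST x y /span_relP[e /ST eT exy]; apply/span_relP; exists e.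
Qed.

Lemma connect_span_constant T (z : vertex G -> 'F_2) x y :
  (forall e x y, e \in T -> val e = [set x; y] -> z x = z y) ->
  connect (span_rel T) x y -> z x = z y.
Proof.
move=> zT /connectP[p]; elim: p x => [|u p IHp] x /=; first by move=> _ ->.
case/andP=> /span_relP[e eT exu] up ylast.
by rewrite (zT e x u) //; apply: IHp.
Qed.

(** A functional vanishing on [T] is a potential constant on components and zero at [w]. If some
    vertex is not joined to [w], the indicator of all such vertices is a nonzero one. *)
Lemma separating_connected T :
  separating incidence T <-> connected_rel (span_rel T).
Proof.
split=> [sep | /forallP conn y y0 v].
  have cw x : connect (span_rel T) w x.
    apply/negPn/negP => nwx.
    have xw : x != w by apply: contraNneq nwx => ->; apply: connect0.
    pose z v := (~~ connect (span_rel T) w v)%:R : 'F_2.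
    have zw : z w = 0 by rewrite /z connect0.
    suff : z x = 0 by rewrite /z nwx => /eqP; rewrite oner_eq0.
    apply: (sep (fun v => z (val v)) _ (exist _ x xw)) => e eT.
    have [a [c [_ _ eac]]] := edgeP e; rewrite (dot_incidence eac zw) /z.
    have r : span_rel T a c by apply/span_relP; exists e.
    rewrite (same_connect_r (sym_connect_sym (span_rel_sym T)) (connect1 r)).
    exact: F2_addxx.
  apply/forallP => x; apply/forallP => y; apply: connect_trans (cw y).
  by rewrite (sym_connect_sym (span_rel_sym T)).
pose z x := if insub x is Some v then y v else 0.
have zE u : z (val u) = y u by rewrite /z valK.
have zw : z w = 0 by rewrite /z insubF ?eqxx.
rewrite -zE -zw; symmetry; apply: (@connect_span_constant T); last exact: (forallP (conn w)).
move=> e a c eT eac; apply: F2_add_eq0.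
rewrite -(dot_incidence eac zw) -[RHS](y0 e eT).
by apply: eq_bigr => u _; rewrite zE.
Qed.

(** The presence of a cycle, seen from one of its edges; it mediates between [acyclic_rel] and
    [indep]. *)
Definition reconnected T := exists e x y,
  [/\ e \in T, val e = [set x; y] & connect (span_rel (T :\ e)) x y].

(** Along a path the incidence vectors telescope to the two ends. *)
Lemma connect_chain S x y : connect (span_rel S) x y ->
  exists2 c : edge G -> 'F_2, (forall e, e \notin S -> c e = 0) &
    forall v, \sum_e c e * incidence e v = (val v == x)%:R + (val v == y)%:R.
Proof.
case/connectP=> p; elim: p x => [|u p IHp] x /=.
  by move=> _ ->; exists (fun=> 0) => // v; rewrite F2_addxx big1 // => e _; rewrite mul0r.
case/andP=> /span_relP[e eS exu] up ylast; have [c cS cE] := IHp u up ylast.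
have xu := edge_neq exu.
exists (fun f => (f == e)%:R + c f) => [f fS|v].
  by rewrite cS // addr0; case: eqP => // fe; rewrite -fe (negbTE fS) in eS.
under eq_bigr => f _ do rewrite mulrDl; rewrite big_split /= cE.
rewrite (bigD1 e) //= eqxx mul1r big1 => [|f /negbTE->]; last by rewrite mul0r.
rewrite /incidence exu !inE addr0.
have -> : ((val v == x) || (val v == u))%:R = (val v == x)%:R + (val v == u)%:R :> 'F_2.
  by case: eqP => [->|]; rewrite ?(negbTE xu) ?addr0 ?add0r.
by rewrite -addrA (addrA (val v == u)%:R) F2_addxx add0r.
Qed.

Lemma indep_not_reconnected T : indep incidence T -> ~ reconnected T.
Proof.
move=> ind [e [x [y [eT exy /connect_chain[c cT cE]]]]].
suff c0 v : \sum_(f in T) ((f == e)%:R + c f) * incidence f v = 0.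
  by have /eqP := ind _ c0 e eT; rewrite eqxx cT ?setD11 // addr0 oner_eq0.
have cTE f : f \notin T -> (f == e)%:R + c f = 0.
  by move=> fT; rewrite cT ?inE ?negb_and ?fT ?orbT // addr0; case: eqP fT => // ->; rewrite eT.
transitivity (\sum_f ((f == e)%:R + c f) * incidence f v).
  by rewrite big_mkcond; apply: eq_bigr => f _; case: ifP => // /negbT/cTE ->; rewrite mul0r.
under eq_bigr => f _ do rewrite mulrDl; rewrite big_split /= cE.
rewrite (bigD1 e) //= eqxx mul1r big1 => [|f /negbTE->]; last by rewrite mul0r.
rewrite /incidence exy !inE addr0.
have -> : ((val v == x) || (val v == y))%:R = (val v == x)%:R + (val v == y)%:R :> 'F_2.
  by case: eqP => [->|]; rewrite ?(negbTE (edge_neq exy)) ?addr0 ?add0r.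
exact: F2_addxx.
Qed.

(** Given a relation involving [e], take the component of one end of [e] among the other edges of
    the relation. Of the edges in the relation only [e] leaves it, so pairing with this cut gives a
    nonzero value. *)
Lemma not_reconnected_indep T : ~ reconnected T -> indep incidence T.
Proof.
move=> nrec x x0 e eT; apply/eqP/negPn/negP => xe; apply: nrec.
have [a [c [_ _ eac]]] := edgeP e.
exists e, a, c; split=> //; apply/negPn/negP => nac.
pose S := [set f in T | x f != 0] :\ e.
have ST : S \subset T :\ e by apply: setSD; apply/subsetP => f; rewrite inE => /andP[].
(* The cut function of the component of [a], normalised to vanish at [w]. *)
pose z0 v := (connect (span_rel S) a v)%:R : 'F_2; pose z v := z0 v + z0 w.
have zw : z w = 0 by apply: F2_addxx.
have zE u v : z u + z v = z0 u + z0 v.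
  by rewrite /z addrACA F2_addxx addr0.
have sum0 : \sum_(f in T) x f * dotF2 (incidence f) (fun v => z (val v)) = 0.
  rewrite /dotF2; under eq_bigr => f _ do rewrite mulr_sumr.
  rewrite exchange_big big1 //= => v _; under eq_bigr => f _ do rewrite mulrA.
  by rewrite -mulr_suml x0 mul0r.
move/eqP: sum0; rewrite (bigD1 e) //= big1 => [|f /andP[fT fe]].
  rewrite addr0 mulf_eq0 (negbTE xe) (dot_incidence eac zw) zE /z0 connect0 /=.
  rewrite (_ : connect (span_rel S) a c = false) ?addr0 ?oner_eq0 //.
  apply: contraNF nac; apply: connect_sub => u v uv; apply: connect1.
  exact: span_rel_subset uv.
have [-> | xf] := eqVneq (x f) 0; first by rewrite mul0r.
have [p [q [_ _ fpq]]] := edgeP f; rewrite (dot_incidence fpq zw) zE /z0.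
have r : span_rel S p q by apply/span_relP; exists f => //; rewrite !inE fe fT.
rewrite (same_connect_r (sym_connect_sym (span_rel_sym S)) (connect1 r)).
by rewrite F2_addxx mulr0.
Qed.

(** A repetition-free path closed by [e] is a cycle, with at least three vertices because an edge is
    determined by its ends. Conversely, the ends of the closing edge of a cycle are joined by its
    other edges. *)
Lemma acyclic_reconnected T : acyclic_rel (span_rel T) <-> ~ reconnected T.
Proof.
split=> [/acyclic_relP acyc [e [x [y [eT exy /connectP[p]]]]] | nrec].
  case/shortenP=> {}p xp up _ yp; have xy := edge_neq exy.
  have sub := span_rel_subset (subsetDl T [set e]).
  apply: (acyc (x :: p)).
    case: p yp xp {up} => [|u [|u' p]] //=; first by move=> yx; rewrite yx eqxx in xy.
    move=> yu /andP[/span_relP[f]]; rewrite !inE => /andP[fe _] fxu _.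
    by case/eqP: fe; apply: val_inj; rewrite /= fxu exy yu.
  rewrite /ucycle up andbT /= rcons_path (sub_path sub) //= -yp.
  by apply/span_relP; exists e => //; rewrite setUC.
apply/acyclic_relP => -[|x [|u p]] // c3; rewrite /ucycle => /andP[].
rewrite /= rcons_path /= => /and3P[/span_relP[f fT fxu] up yx] /andP[xup uup].
apply: nrec; have {yx}/span_relP[e eT eyx] := yx.
exists e, x, (last u p); split; rewrite // 1?setUC //.
have ex : x \in val e by rewrite eyx !inE eqxx orbT.
apply/connectP; exists (u :: p) => //=; apply/andP; split.
  apply/span_relP; exists f => //; rewrite !inE fT andbT.
  (* If the first edge were the closing one, [u] would be the last vertex and the cycle would have
     only two vertices. *)
  apply: contraTneq c3 => fe; rewrite -leqNgt.
  have : u \in [set last u p; x] by rewrite -eyx -fe fxu !inE eqxx orbT.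
  rewrite !inE; case/orP=> [/eqP ulast | /eqP ux]; last by rewrite ux !inE eqxx in xup.
  case: p uup ulast {up xup eyx} => [|v p] //= /andP[uvp _] ulast.
  by rewrite ulast mem_last in uvp.
apply: (sub_in_path (P := predC1 x) (e := span_rel T)) up => [y z yx zx /span_relP[g gT gyz]|].
  apply/span_relP; exists g; rewrite // !inE gT andbT.
  apply: contraTneq ex => <-; rewrite gyz !inE negb_or.
  by move: yx zx; rewrite !inE !(eq_sym x) => -> ->.
by apply/allP => v vup /=; apply: contraNneq xup => <-.
Qed.

Theorem spanning_tree_basis T : spanning_tree T = is_basis incidence T.
Proof.
apply/andP/idP => [[conn acyc] | /basisP[ind sep]].
  apply/basisP; split; last exact/separating_connected.
  exact/not_reconnected_indep/acyclic_reconnected.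
by split; [exact/separating_connected | exact/acyclic_reconnected/indep_not_reconnected].
Qed.

(** The monomial of [T] takes the value 1 exactly when [T] contains every edge where [a]
    vanishes. *)
Lemma kirchhoff_zero_set (a : {ffun edge G -> 'F_2}) :
  (kirchhoff G 'F_2).@[fun i => a (enum_val i)] =
  basis_count incidence [set e | a e == 0].
Proof.
rewrite /kirchhoff rmorph_sum /= /basis_count [LHS]big_mkcond [RHS]big_mkcond /=.
apply: eq_bigr => T _; rewrite spanning_tree_basis; case: ifP => bT; last by rewrite if_same.
rewrite rmorph_prod /=; under eq_bigr => e _ do rewrite mevalXU enum_rankK.
case: (boolP (_ \subset T)) => [/subsetP sub | /subsetPn[e]].
  apply: big1 => e eT; rewrite [LHS]F2_eq01; case: eqP => // /eqP ae.
  by rewrite sub ?inE in eT.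
by rewrite inE => /eqP ae eT; rewrite (bigD1 e) //= ae mul0r.
Qed.

Lemma card_kirchhoff_zeros :
  #|kirchhoff_zeros G 2| = #|[set C | basis_count incidence C == 0]|.
Proof.
pose f (a : {ffun edge G -> 'F_2}) := [set e | a e == 0].
have f_inj : injective f.
  move=> a a' /setP aa; apply/ffunP => e; have := aa e; rewrite !inE.
  by move=> E; rewrite (F2_eq01 (a e)) (F2_eq01 (a' e)) E.
rewrite -(card_imset _ f_inj); apply: eq_card => C; apply/imsetP/idP => [[a]|].
  by rewrite !inE kirchhoff_zero_set => h ->.
rewrite inE => h; pose a : {ffun edge G -> 'F_2} := [ffun e => (e \notin C)%:R].
have fa : f a = C.
  by apply/setP => e; rewrite !inE ffunE; case: (e \in C).
by exists a; rewrite // inE kirchhoff_zero_set -/(f a) fa.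
Qed.

End Incidence.

(** * Twin vertices *)

(** Orbits of size two cancel in characteristic 2; comparing [enum_rank] selects one member of
    each. *)
Lemma F2_sum_involution (I : finType) (P : pred I) (f : I -> I) (h : I -> 'F_2) :
  involutive f -> (forall i, P (f i) = P i) -> (forall i, h (f i) = h i) ->
  (forall i, P i -> f i = i -> h i = 0) -> \sum_(i | P i) h i = 0.
Proof.
move=> ff Pf hf hfix.
rewrite (bigID (fun i => enum_rank i < enum_rank (f i))%N) /=.
rewrite [X in _ + X](bigID (fun i => f i == i)) /= [X in _ + (X + _)]big1 ?add0r; last first.
  by move=> i /andP[/andP[Pi _] /eqP fi]; apply: hfix.
rewrite [X in _ + X](reindex_inj (inv_inj ff)) /= [X in _ + X](eq_bigr h) => [|i _] //.
rewrite [X in _ + X](eq_bigl (fun i => P i && (enum_rank i < enum_rank (f i))%N)) ?F2_addxx //.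
move=> i; rewrite Pf ff -leqNgt -andbA; congr (_ && _).
rewrite ltn_neqAle andbC; congr (_ && _).
by rewrite (inj_eq val_inj) (inj_eq enum_rank_inj).
Qed.

Lemma indep_subset (E V : finType) (b : E -> V -> 'F_2) (S U : {set E}) :
  S \subset U -> indep b U -> indep b S.
Proof.
move=> /subsetP SU ind x x0 e eS.
have := ind (fun f => if f \in S then x f else 0) _ e (SU e eS).
rewrite eS; apply=> v; rewrite -[RHS](x0 v) [LHS]big_mkcond [RHS]big_mkcond.
apply: eq_bigr => f _; case: (boolP (f \in S)) => [/SU->|_] //.
by rewrite mul0r if_same.
Qed.

Section Twins.
Variable G : sgraph.
Implicit Types (x y : vertex G) (e : edge G) (S T : {set edge G}).

Lemma adj_edge x y : adj x y -> exists e : edge G, val e = [set x; y].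
Proof.
move=> xy; have exy : [set x; y] \in edges G.
  by rewrite inE; apply/existsP; exists x; apply/existsP; exists y; rewrite xy /=.
by exists (exist (fun A => A \in edges G) _ exy).
Qed.

Lemma edge_adj e x y : val e = [set x; y] -> adj x y.
Proof.
move=> exy; have := edge_neq exy; have [a [c [ac _ eac]]] := edgeP e.
have : x \in [set a; c] by rewrite -eac exy !inE eqxx.
have : y \in [set a; c] by rewrite -eac exy !inE eqxx orbT.
rewrite !inE => /orP[]/eqP-> /orP[]/eqP->; rewrite ?eqxx //.
by rewrite adj_sym.
Qed.

Variables (w p q : vertex G).
Hypotheses (pq : p != q) (pw : p != w) (qw : q != w).
Hypothesis twins : forall x, adj p x = adj q x.

Local Notation tau := (tperm p q).

Lemma adj_tperm x y : adj (tau x) (tau y) = adj x y.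
Proof.
have tw u v : adj (tau u) v = adj u v.
  by rewrite permE /=; case: eqP => [->|_]; [rewrite twins | case: eqP => [->|]; rewrite ?twins].
by rewrite tw adj_sym tw adj_sym.
Qed.

Lemma tau_edge e : tau @: val e \in edges G.
Proof.
have [x [y [xy _ ->]]] := edgeP e; rewrite inE; apply/existsP; exists (tau x).
by apply/existsP; exists (tau y); rewrite adj_tperm xy /= imsetU1 imset_set1.
Qed.

Definition swap_edge e : edge G := exist (fun A => A \in edges G) (tau @: val e) (tau_edge e).

Lemma tau_imsetK (A : {set vertex G}) : tau @: (tau @: A) = A.
Proof.
by rewrite -imset_comp -[RHS]imset_id; apply: eq_imset => x /=; rewrite tpermK.
Qed.

Lemma swap_edgeK : involutive swap_edge.
Proof. by move=> e; apply: val_inj; rewrite /= tau_imsetK. Qed.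

Lemma tau_w : tau w = w.
Proof. by rewrite tpermD. Qed.

Lemma tau_neq (v : {v : vertex G | v != w}) : tau (val v) != w.
Proof. by rewrite -[X in _ != X]tau_w (inj_eq perm_inj) (valP v). Qed.

Definition swap_vertex (v : {v : vertex G | v != w}) : {v : vertex G | v != w} :=
  exist (fun v => v != w) (tau (val v)) (tau_neq v).

Lemma swap_vertexK : involutive swap_vertex.
Proof. by move=> v; apply: val_inj; rewrite /= tpermK. Qed.

Definition swap_edge_perm := perm (inv_inj swap_edgeK).
Definition swap_vertex_perm := perm (inv_inj swap_vertexK).
Local Notation pi := swap_edge_perm.
Local Notation rho := swap_vertex_perm.

Lemma incidence_swap e v : incidence (pi e) (rho v) = incidence e v.
Proof. by rewrite !permE /incidence /= (mem_imset _ _ perm_inj). Qed.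

(** Invariance puts the edges from [q] to [x] and [y] in [S] as well, and the four edges form a
    4-cycle, whose incidence vectors sum to zero. *)
Lemma twins_not_indep x y S ex ey : x != y -> pi @: S = S ->
  val ex = [set p; x] -> val ey = [set p; y] -> ex \in S -> ey \in S ->
  ~ indep (@incidence G w) S.
Proof.
move=> xy piS exE eyE exS eyS ind.
have px := edge_neq exE; have py := edge_neq eyE.
have piE e : (pi e \in S) = (e \in S) by rewrite -{1}piS (mem_imset _ _ perm_inj).
have q_neq u e : val e = [set p; u] -> q != u.
  by move=> /edge_adj; apply: contraTneq => <-; rewrite twins adj_irrefl.
have piE' e u : val e = [set p; u] -> val (pi e) = [set q; u].
  move=> eu; rewrite permE /= eu imsetU1 imset_set1 tpermL tpermD //.
    exact: edge_neq eu.
  exact: q_neq eu.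
have piexE := piE' _ _ exE; have pieyE := piE' _ _ eyE.
pose c f : 'F_2 := (f == ex)%:R + (f == ey)%:R + (f == pi ex)%:R + (f == pi ey)%:R.
have delta (e : edge G) (v : {v : vertex G | v != w}) : e \in S ->
    \sum_(f in S) (f == e)%:R * incidence f v = (val v \in val e)%:R.
  move=> eS; rewrite (bigD1 e) //= eqxx mul1r big1 ?addr0 // => f /andP[_ /negbTE->].
  by rewrite mul0r.
have c0 (v : {v : vertex G | v != w}) : \sum_(f in S) c f * incidence f v = 0.
  have set2E (a a' : vertex G) : a != a' ->
      (val v \in [set a; a'])%:R = (val v == a)%:R + (val v == a')%:R :> 'F_2.
    by move=> aa'; rewrite !inE; case: eqP => [->|]; rewrite ?(negbTE aa') ?addr0 ?add0r.
  have piexS : pi ex \in S by rewrite piE.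
  have pieyS : pi ey \in S by rewrite piE.
  transitivity ((val v \in val ex)%:R + (val v \in val ey)%:R +
    (val v \in val (pi ex))%:R + (val v \in val (pi ey))%:R : 'F_2).
    rewrite -(delta ex v exS) -(delta ey v eyS) -(delta _ v piexS) -(delta _ v pieyS).
    by rewrite -!big_split; apply: eq_bigr => f _; rewrite /c !mulrDl.
  rewrite exE eyE piexE pieyE !set2E ?(q_neq _ _ exE) ?(q_neq _ _ eyE) //.
  by case: (_ == p); case: (_ == q); case: (_ == x); case: (_ == y); apply/val_inj.
have ne e : p \notin val e -> (ex == e) = false.
  by move=> pe; apply: contraNF pe => /eqP <-; rewrite exE !inE eqxx.
have exey : (ex == ey) = false.
  apply: contraNF xy => /eqP exy; have : x \in val ey by rewrite -exy exE !inE eqxx orbT.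
  by rewrite eyE !inE => /orP[/eqP xp|//]; rewrite xp eqxx in px.
by have := ind c c0 ex exS; rewrite /c eqxx exey !ne ?piexE ?pieyE ?inE ?negb_or ?pq.
Qed.

Variables a1 a2 a3 : vertex G.
Hypothesis a123 : uniq [:: a1; a2; a3].
Hypothesis adj_w : forall x, adj w x = (x \in [:: a1; a2; a3]).
Hypothesis npw : ~~ adj p w.
Hypothesis deg_p : (2 < #|[set x | adj p x]|)%N.
Hypothesis card_edges : (#|edge G| + 2 <= 2 * #|vertex G|)%N.

Section Marked.
Variables e1 e2 e3 : edge G.
Hypotheses (e1E : val e1 = [set w; a1]) (e2E : val e2 = [set w; a2]) (e3E : val e3 = [set w; a3]).

Local Notation B := (base3 e1 e2 e3).
Local Notation ins := (insert3 e1 e2 e3).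
Local Notation b := (@incidence G w).

Let e123 : uniq [:: e1; e2; e3].
Proof.
have wa a : a \in [:: a1; a2; a3] -> w != a.
  by rewrite -adj_w; apply: contraTneq => <-; rewrite adj_irrefl.
have ne e f a a' : val e = [set w; a] -> val f = [set w; a'] -> a \in [:: a1; a2; a3] ->
    a != a' -> e != f.
  move=> eE fE aD; apply: contraNneq => ef.
  have : a \in val f by rewrite -ef eE !inE eqxx orbT.
  by rewrite fE !inE => /orP[/eqP aw|//]; have := wa _ aD; rewrite aw eqxx.
move: a123; rewrite /= !inE !negb_or => /and3P[/andP[a12 a13] a23 _].
by rewrite (ne e1 e2 a1 a2) ?(ne e1 e3 a1 a3) ?(ne e2 e3 a2 a3) // !inE eqxx ?orbT.
Qed.

Let edge_w e : (e \in [set e1; e2; e3]) = (w \in val e).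
Proof.
apply/idP/idP => [|we].
  by rewrite !inE => /orP[/orP[]|] /eqP->; rewrite ?e1E ?e2E ?e3E !inE eqxx.
have [x [y [xy _ exy]]] := edgeP e.
have [a wa ea] : exists2 a, adj w a & val e = [set w; a].
  move: we; rewrite exy !inE => /orP[]/eqP->; first by exists y.
  by exists x; rewrite 1?setUC // adj_sym.
by move: wa; rewrite adj_w !inE => /or3P[]/eqP aE; rewrite aE in ea;
  rewrite -!(inj_eq val_inj) ea e1E e2E e3E eqxx ?orbT.
Qed.

Let b_phi e : dotF2 (b e) (fun v => (val v != w)%:R) = (e \in [set e1; e2; e3])%:R.
Proof.
rewrite edge_w; have [x [y [_ xy exy]]] := edgeP e.
rewrite (dot_incidence (z := fun v => (v != w)%:R) exy) ?eqxx // exy !inE !(eq_sym w).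
have [xw|_] := eqVneq x w; have [yw|_] := eqVneq y w; rewrite ?F2_addxx ?addr0 ?add0r //.
by rewrite xw yw eqxx in xy.
Qed.

Let tau_a a : a \in [:: a1; a2; a3] -> tau a = a.
Proof.
rewrite -adj_w => wa; rewrite tpermD //.
  by apply: contraNneq npw => ->; rewrite adj_sym.
by apply: contraNneq npw => qa; rewrite twins qa adj_sym.
Qed.

Let pi_D e : e \in [set e1; e2; e3] -> pi e = e.
Proof.
rewrite !inE => eD; apply: val_inj; rewrite permE /=.
by case/orP: eD => [/orP[]|] /eqP->; rewrite ?e1E ?e2E ?e3E imsetU1 imset_set1 tau_w tau_a //
  !inE eqxx ?orbT.
Qed.

Let D1 : e1 \in [set e1; e2; e3]. Proof. by rewrite !inE eqxx. Qed.
Let D2 : e2 \in [set e1; e2; e3]. Proof. by rewrite !inE eqxx orbT. Qed.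
Let D3 : e3 \in [set e1; e2; e3]. Proof. by rewrite !inE eqxx orbT. Qed.

Let pi_insert3 t1 t2 t3 S : pi @: ins t1 t2 t3 S = ins t1 t2 t3 (pi @: S).
Proof.
have pi_insert e t U : e \in [set e1; e2; e3] -> pi @: insert e t U = insert e t (pi @: U).
  by move=> eD; rewrite /insert; case: t => //; rewrite imsetU1 pi_D.
by rewrite /insert3 !pi_insert.
Qed.

Let pi_base S : (pi @: S \subset B) = (S \subset B).
Proof.
have piB : pi @: B = B.
  apply/setP => e; rewrite -[e](permKV pi) (mem_imset _ _ perm_inj).
  set f := (pi^-1)%g e; rewrite !in_setC; congr (~~ _).
  by rewrite !edge_w permE /= -[X in _ = (X \in _)]tau_w (mem_imset _ _ perm_inj).
by rewrite -{1}piB; apply/subsetP/subsetP => sub e eS;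
  [rewrite -(mem_imset _ _ (@perm_inj _ pi)); apply: sub; apply: imset_f |
   case/imsetP: eS => f fS ->; apply: imset_f; apply: sub].
Qed.

Let mixed_swap e v : mixed b e2 e3 (pi e) (rho v) = mixed b e2 e3 e v.
Proof.
have piD f : f \in [set e1; e2; e3] -> (pi e == f) = (e == f).
  by move=> fD; rewrite -{1}(pi_D fD) (inj_eq perm_inj).
rewrite /mixed /restrict !inE !piD //; case: eqP => _.
  by rewrite -{1}(pi_D D3) incidence_swap.
by case: eqP => _ //=; rewrite incidence_swap.
Qed.

Let tree_swap S : tree_part b e1 e2 e3 (pi @: S) = tree_part b e1 e2 e3 S.
Proof. by rewrite /tree_part -pi_insert3 (imset_basis _ incidence_swap). Qed.

Let forest_swap S : forest_part b e1 e2 e3 (pi @: S) = forest_part b e1 e2 e3 S.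
Proof.
rewrite /forest_part /mixed_basis -!pi_insert3 !(imset_basis _ incidence_swap).
by rewrite (imset_basis _ mixed_swap).
Qed.

Let cardV : #|{: {v : vertex G | v != w}}| = #|vertex G|.-1.
Proof. by rewrite card_sig -(cardC1 w); apply: eq_card => v; rewrite !inE. Qed.

Let V3 : (2 < #|{: {v : vertex G | v != w}}|)%N.
Proof.
rewrite card_sig; apply: (@leq_trans #|[:: a1; a2; a3]|); first by rewrite (card_uniqP a123).
apply/subset_leq_card/subsetP => a; rewrite -adj_w => wa; rewrite unfold_in.
by apply: contraTneq wa => ->; rewrite adj_irrefl.
Qed.

Let notinB S e : S \subset B -> e \in [set e1; e2; e3] -> e \notin S.
Proof. by move=> /subsetP SB eD; apply: contraL eD => /SB; rewrite in_setC. Qed.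

(* By the edge count, an invariant complementary pair would put two of the edges
   at [p], hence the 4-cycle through [p], [q] and their other ends, in one part. *)
Let fixed_pair T S : T \subset B -> S \subset B -> [disjoint T & S] ->
  pi @: T = T -> pi @: S = S ->
  tree_part b e1 e2 e3 T * forest_part b e1 e2 e3 S = 0.
Proof.
move=> TB SB dTS piT piS; apply/eqP/negPn/negP; rewrite mulf_eq0 negb_or => /andP[].
rewrite /tree_part /forest_part; case: (boolP (is_basis _ _)) => //; rewrite /insert3 /= => bT _.
have [cT indT] : #|T|.+1 = #|{: {v : vertex G | v != w}}| /\ indep b T.
  split; first by rewrite -(basis_card bT) cardsU1 notinB.
  by have /basisP[ind _] := bT; apply: indep_subset ind; apply: subsetUr.
move=> forest; have {forest} [cS indS] :
    #|S|.+2 = #|{: {v : vertex G | v != w}}| /\ indep b S.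
  have [e [f [eD fD ef bS]]] : exists e f, [/\ e \in [set e1; e2; e3], f \in [set e1; e2; e3],
      e != f & is_basis b (e |: (f |: S))].
    move: e123; rewrite /= !inE negb_or => /and3P[/andP[e12 e13] _ _].
    case b13 : (is_basis b (e1 |: (e3 |: S))); first by exists e1, e3.
    case b12 : (is_basis b (e1 |: (e2 |: S))); first by exists e1, e2.
    by move: forest; rewrite /mixed_basis /insert3 /= b13 b12 !addr0 eqxx.
  split; first by rewrite -(basis_card bS) !cardsU1 !inE (negbTE ef) !notinB.
  by have /basisP[ind _] := bS; apply: indep_subset ind; rewrite setUA; apply: subsetUr.
(* Here [#|T| = #|vertex G| - 2] and [#|S| = #|vertex G| - 3], while [B] has [#|edge G| - 3]
   elements, at most [2 * #|vertex G| - 5]; so the disjoint union fills [B]. *)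
have TS e : e \in B -> (e \in T) || (e \in S).
  have TSB : T :|: S \subset B by rewrite subUset TB.
  suff /eqP <- : T :|: S == B by rewrite inE.
  rewrite eqEcard TSB cardsU; move: dTS; rewrite -setI_eq0 => /eqP->.
  rewrite cards0 subn0; have cB := cardsC [set e1; e2; e3].
  move: cB cT cS; rewrite cardV (card_set3 e123) -/B => cB cT cS.
  by rewrite -(leq_add2l 3) [X in (X <= _)%N]cB; move: card_edges; clear -cT cS; lia.
have [x [y [z [[px py pz] [xy yz zx]]]]] := card_gt2P deg_p; rewrite !inE in px py pz.
have edge_part u : adj p u -> exists2 e : edge G, val e = [set p; u] & (e \in T) || (e \in S).
  move=> pu; have [e eE] := adj_edge pu; exists e => //; apply: TS.
  rewrite in_setC edge_w eE !inE negb_or (eq_sym w p) pw.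
  by apply: contraNneq npw => ->.
have [ex exE exTS] := edge_part x px; have [ey eyE eyTS] := edge_part y py.
have [ez ezE ezTS] := edge_part z pz.
have nT u v eu ev := @twins_not_indep u v T eu ev.
have nS u v eu ev := @twins_not_indep u v S eu ev.
case/orP: exTS => [xT|xS]; case/orP: eyTS => [yT|yS].
- exact: (nT x y ex ey).
- case/orP: ezTS => [zT|zS]; first exact: (nT z x ez ex).
  exact: (nS y z ey ez).
- case/orP: ezTS => [zT|zS]; first exact: (nT y z ey ez).
  exact: (nS z x ez ex).
- exact: (nS x y ex ey).
Qed.

(** Swapping the twins in both members is an involution on the disjoint pairs that preserves the
    summand, and [fixed_pair] handles its fixed points. *)
Lemma marked_zeros : (8 %| #|kirchhoff_zeros G 2|)%N.
Proof.
rewrite (card_kirchhoff_zeros w); apply: (zeros_mod8 e123 b_phi V3).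
rewrite pair_big_dep /=.
pose swap (TS : {set edge G} * {set edge G}) := (pi @: TS.1, pi @: TS.2).
apply: (F2_sum_involution (f := swap)); rewrite /swap /=.
- have piK (U : {set edge G}) : pi @: (pi @: U) = U.
    rewrite -imset_comp -[RHS]imset_id; apply: eq_imset => e /=.
    by rewrite !permE swap_edgeK.
  by case=> T S /=; rewrite !piK.
- move=> [T S] /=; rewrite !pi_base; congr [&& _, _ & _].
  rewrite -!setI_eq0 -imsetI; last by move=> ? ? _ _; apply: perm_inj.
  by rewrite imset_eq0.
- by move=> [T S] /=; rewrite tree_swap forest_swap.
- by move=> [T S] /= /and3P[TB SB dTS] [piT piS]; apply: fixed_pair.
Qed.

End Marked.

Theorem twins_kirchhoff_zeros : (8 %| #|kirchhoff_zeros G 2|)%N.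
Proof.
have wa a : a \in [:: a1; a2; a3] -> exists e : edge G, val e = [set w; a].
  by rewrite -adj_w => /adj_edge.
have [|e1 e1E] := wa a1; first by rewrite !inE eqxx.
have [|e2 e2E] := wa a2; first by rewrite !inE eqxx orbT.
have [|e3 e3E] := wa a3; first by rewrite !inE eqxx !orbT.
exact: marked_zeros e1E e2E e3E.
Qed.

End Twins.

(** * The ladder *)

Section Ladder.
Variable m : nat.
Hypothesis hm : (4 <= m)%N.
Local Notation G := (decompleted_xladder m).

Let m1 : (1 < m)%N. Proof. exact: leq_trans hm. Qed.

Let Zm_eq i j : (i < m)%N -> (j < m)%N -> (i%:R == j%:R :> 'Z_m) = (i == j).
Proof.
by move=> im jm; rewrite -(inj_eq val_inj) /= !val_Zp_nat // !modn_small.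
Qed.

Let Zm01 : (0 == 1 :> 'Z_m) = false. Proof. exact: (@Zm_eq 0 1 (ltnW m1) m1). Qed.

Let cardZm : #|'Z_m| = m. Proof. by rewrite card_ord Zp_cast. Qed.

Lemma card_vertex_decompleted : #|vertex G| = (2 * m).-1.
Proof.
transitivity #|predC1 (ladder_u (1 : 'Z_m))|.
  by rewrite card_sig; apply: eq_card => v; rewrite !inE.
by rewrite cardC1 card_prod cardZm card_bool mulnC.
Qed.

Lemma card_edge_decompleted : (#|edge G| + 4 <= 4 * m)%N.
Proof.
(* The triple [(i, s, t)] codes the edge from [(i, s)] to [(i + 1, t)]; the four codes in [X] are
   those of edges at the deleted vertex. *)
pose X : seq ('Z_m * bool * bool) := [:: (1, false, false); (1, false, true);
  (0, false, false); (0, true, false)].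
pose A := [set t | t \notin X].
pose F (t : 'Z_m * bool * bool) : {set 'Z_m * bool} := [set t.1; (t.1.1 + 1, t.2)].
pose g (e : edge G) : {set 'Z_m * bool} := val @: val e.
have g_inj : injective g.
  move=> e f /imset_inj ef; apply: val_inj; exact: ef val_inj.
have sub : g @: [set: edge G] \subset F @: A.
  apply/subsetP => _ /imsetP[e _ ->]; have [x [y [xy _ exy]]] := edgeP e.
  suff {e exy} gen (u v : vertex G) : (val v).1 == (val u).1 + 1 -> [set val u; val v] \in F @: A.
    rewrite /g exy imsetU1 imset_set1; case/orP: xy => [/gen //|/gen].
    by rewrite setUC.
  move=> /eqP uv; apply/imsetP; exists ((val u), (val v).2); last first.
    by rewrite /F /= -uv -surjective_pairing.
  have vu := valP u; have vv := valP v; rewrite inE; apply/negP; move: uv vu vv.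
  case: (val u) => i s; case: (val v) => j t /= -> vu vv.
  rewrite !inE => /or4P[]/eqP[ie].
  - by move=> se _; rewrite ie se eqxx in vu.
  - by move=> se _; rewrite ie se eqxx in vu.
  - by move=> _ te; rewrite ie te add0r eqxx in vv.
  - by move=> _ te; rewrite ie te add0r eqxx in vv.
have uX : uniq X by [].

have X4 : #|X| = 4%N by rewrite (card_uniqP uX).
have : (#|edge G| <= #|A|)%N.
  rewrite -cardsT -(card_imset _ g_inj).
  by apply: leq_trans (subset_leq_card sub) (leq_imset_card _ _).
have := cardC (mem X); rewrite !card_prod cardZm card_bool X4.
have -> : #|A| = #|[predC mem X]| by apply: eq_card => t; rewrite inE.
move: #|[predC mem X]| => x; move: #|edge G| => y; lia.
Qed.

Lemma decompleted_zeros : (8 %| #|kirchhoff_zeros G 2|)%N.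
Proof.
have neq (i : 'Z_m) (t : bool) : (i != 1) || t -> (i, t) != ladder_u (1 : 'Z_m).
  by move=> it; rewrite xpair_eqE negb_and eqbF_neg negbK.
pose vtx (i : 'Z_m) t (h : (i != 1) || t) : vertex G :=
  exist (fun x => x != ladder_u 1) (i, t) (neq i t h).
have h0 t : ((0 : 'Z_m) != 1) || t by rewrite Zm01.
have h1 : ((1 : 'Z_m) != 1) || true by rewrite orbT.
have h2 : ((2%:R : 'Z_m) != 1) || false by rewrite (@Zm_eq 2 1) // (leq_trans _ hm).
have h3 t : ((3%:R : 'Z_m) != 1) || t by rewrite (@Zm_eq 3 1) // (leq_trans _ hm).
have ZN1 : (-1 == 1 :> 'Z_m) = false.
  by rewrite eq_sym -subr_eq0 opprK (@Zm_eq 2 0) // (leq_trans _ hm).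
have hN t : ((-1 : 'Z_m) != 1) || t.
  by rewrite ZN1.
have m2 : (2 < m)%N by apply: leq_trans hm.
have m0 : (0 < m)%N by apply: leq_trans hm.
have Z02 : (0 == 2%:R :> 'Z_m) = false by apply: (@Zm_eq 0 2).
have Z03 : (0 == 3%:R :> 'Z_m) = false by apply: (@Zm_eq 0 3).
have Z13 : (1 == 3%:R :> 'Z_m) = false by apply: (@Zm_eq 1 3).
have Z21 : (2%:R == 1 :> 'Z_m) = false by apply: (@Zm_eq 2 1).
have vtx_eq i j s t hi hj : (vtx i s hi == vtx j t hj) = (i == j) && (s == t).
  by rewrite -(inj_eq val_inj) /= xpair_eqE.
(* The vertex u_2 keeps the neighbours v_1, u_3, v_3. The twins u_0 and v_0 have equal
   neighbourhoods because adjacency sees only the index, and they are not adjacent to u_2 since 0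
   and 3 differ modulo [m >= 4]. *)
apply: (@twins_kirchhoff_zeros G (vtx 2%:R false h2)
  (vtx 0 false (h0 false)) (vtx 0 true (h0 true)) _ _ _ _
  (vtx 1 true h1) (vtx 3%:R false (h3 false)) (vtx 3%:R true (h3 true))).
- by rewrite vtx_eq andbF.
- by rewrite vtx_eq Z02.
- by rewrite vtx_eq Z02.
- by [].
- by rewrite /= !inE !vtx_eq !andbF Z13.
- move=> [[i t] it]; rewrite !inE -!(inj_eq val_inj) /= !xpair_eqE /=.
  rewrite /adj /= /del_vertex_adj /= /xladder_adj /=.
  have -> : (2%:R == i + 1) = (i == 1) by rewrite -natr1 (inj_eq (addIr 1)) eq_sym.
  rewrite natr1; move: it; rewrite xpair_eqE.
  by case: t; case: (i == 1); case: (i == 3%:R).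
- rewrite /adj /= /del_vertex_adj /= /xladder_adj /= add0r natr1 negb_or.
  by rewrite Z21 Z03.
- apply/card_gt2P; exists (vtx 1 true h1), (vtx (-1) false (hN false)), (vtx (-1) true (hN true)).
  rewrite !inE !vtx_eq !andbF /adj /= /del_vertex_adj /= /xladder_adj /=.
  by rewrite ZN1 add0r addNr !eqxx !orbT.
(* The bound reads [#|edge G| + 2 <= 4 * m - 2], the right side being [2 * #|vertex G|]. *)
- by rewrite card_vertex_decompleted; have := card_edge_decompleted; move: hm; lia.
Qed.

End Ladder.

Theorem proposition4p2 (m : nat) (hm : (4 <= m)%N) :
  c2 (decompleted_xladder m) 2 = 0.
Proof.
have /dvdnP[k zk] := decompleted_zeros hm.
(* With [k * 8] zeros the quotient by [2 ^ 2] is [k * 2], which vanishes mod 2. *)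
rewrite /c2 zk -[8%N]/(2 * 2 ^ 2)%N mulnA mulnK // F2_natr oddM andbF //.
Qed.
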